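(* Let $\mathbb{N}$ be finitely colored and let $x=(x_i)_{i\ge1}\subset\mathbb{N}$ be a sequence such that $\mathrm{FS}(x)$ is monochromatic. Fix $p\in(0,1)$ and let $(\varepsilon_i)_{i\ge1}$ be i.i.d. $\mathrm{Bernoulli}(p)$ random variables. Let $(y_k)_{k\ge1}=(x_{n_k})_{k\ge1}$ be any subsequence of distinct elements of $x$. For $k\ge1$ set \[ S_k=\sum_{j=1}^k \varepsilon_{n_j}y_j,\qquad \mu_k=\mathbb{E}[S_k]=p\sum_{j=1}^k y_j,\qquad \sigma_k^2=\operatorname{Var}(S_k)=p(1-p)\sum_{j=1}^k y_j^2 . \] Assume $\sum_{j=1}^\infty y_j^2=\infty$ and write $j_k$ for an index achieving the maximum at stage $k$, i.e. $y_{j_k}^2=\max_{1\le j\le k}y_j^2$. Set the residual squared sum $R_k:=\sum_{1\le j\le k,\ j\ne j_k}y_j^2$. Then the following statements are true (the two behaviors below are not logically exclusive in general; they describe the two distinct limiting regimes that can occur and their consequences). (A) (Dominated single-term regime.) If \[ \frac{y_{j_k}^2}{y_{j_k}^2+R_k}\xrightarrow[k\to\infty]{}1, \] then the variance is asymptotically carried by the single largest summand. In this case \[ \frac{S_k-\mu_k}{\sigma_k}\xrightarrow{d}\frac{B-p}{\sqrt{p(1-p)}},\qquad B\sim\mathrm{Bernoulli}(p). \] Equivalently, the limit law is the two-point distribution taking the value $\frac{1-p}{\sqrt{p(1-p)}}$ with probability $p$ and the value $\frac{-p}{\sqrt{p(1-p)}}$ with probability $1-p$. In particular, no nondegenerate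 Gaussian limit can hold for the full sums under this normalization. (B) (Trimmed CLT regime.) Suppose instead that there exists a deterministic choice of indices $j_k$ (for instance the argmax indices) such that, with $R_k=\sum_{1\le j\le k,\ j\ne j_k}y_j^2$ for this choice, the trimmed variance satisfies \[ (\sigma_k^{\mathrm{trim}})^2:=p(1-p)R_k\xrightarrow[k\to\infty]{}\infty \] and the largest remaining squared term is negligible relative to the residual, i.e. \[ \frac{\max_{1\le j\le k,\ j\ne j_k}y_j^2}{R_k}\xrightarrow[k\to\infty]{}0 . \] Then the centered trimmed sums formed from $S_k^{\mathrm{trim}}:=\sum_{1\le j\le k,\ j\ne j_k}\varepsilon_{n_j}y_j$ satisfy the Lindeberg condition, and therefore \[ \frac{S_k^{\mathrm{trim}}-\mathbb{E}[S_k^{\mathrm{trim}}]}{\sigma_k^{\mathrm{trim}}}\xrightarrow{d}\mathcal{N}(0,1). \] Moreover, if the removed (dominating) term is negligible relative to the trimmed variance in the sense that $y_{j_k}^2/R_k\to0$ as $k\to\infty$, then reinserting it does not change the Gaussian limit and one obtains \[ \frac{S_k-\mu_k}{\sigma_k^{\mathrm{trim}}}\xrightarrow{d}\mathcal{N}(0,1). \] (If instead $y_{j_k}^2/R_k\not\to0$, then reinsertion typically changes the limit and one does not obtain a Gaussian law with the trimmed normalization.) In all cases, every atom (point-mass value) of $S_k$ (respectively of any trimmed sum) is a finite sum of elements from $\{y_1,\dots,y_k\}$ and hence lies in $\mathrm{FS}(x)$.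
   Context: $\mathbb{N}$ is the set of natural numbers. For a sequence $x=(x_i)_{i\ge1}$ in $\mathbb{N}$, $\mathrm{FS}(x):=\{\sum_{i\in F}x_i:\ F\subset\{1,2,\dots\}\text{ finite},\ F\neq\varnothing\}$. A set is monochromatic if it lies in a single color class of the coloring. $\sigma_k$ and $\sigma_k^{\mathrm{trim}}$ denote the nonnegative square roots of $\sigma_k^2$ and $(\sigma_k^{\mathrm{trim}})^2$. $\xrightarrow{d}$ denotes convergence in distribution. The Lindeberg condition for the trimmed sums means: with $Z_{k,j}:=\varepsilon_{n_j}y_j-py_j$, for every $\delta>0$, \[ \frac{1}{(\sigma_k^{\mathrm{trim}})^2}\sum_{1\le j\le k,\ j\ne j_k}\mathbb{E}\big[Z_{k,j}^2\mathbf{1}_{\{|Z_{k,j}|>\delta\sigma_k^{\mathrm{trim}}\}}\big]\xrightarrow[k\to\infty]{}0 . \]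
   Formalization: In the last sentence, an atom is shown to lie in FS(x) only when it is a nonempty sum of the y_j; the atom 0 (all ε equal to 0, probability (1-p)^k > 0) is excluded, since FS(x) uses only nonempty F and need not contain 0. *)

(* Defs.v *)
From HB Require Import structures.
From mathcomp Require Import all_boot all_order all_algebra.
From mathcomp Require Import finmap.
From mathcomp Require Import all_classical all_reals all_analysis measurable_realfun.

Set Implicit Arguments.
Unset Strict Implicit.
Unset Printing Implicit Defensive.

Import Order.TTheory GRing.Theory Num.Theory.
Import numFieldNormedType.Exports.

Local Open Scope classical_set_scope.
Local Open Scope ring_scope.

(* All sequences are indexed from 0: [x i] is the mathematical x_{i+1}, and
   the index range 1 <= j <= k becomes [j < k]. *)

Definition FS (x : nat -> nat) : set nat :=
  [set s | exists2 F : {fset nat}, F != fset0 & s = (\sum_(i <- F) x i)%N].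

Definition monochromatic (r : nat) (c : nat -> 'I_r) (A : set nat) : Prop :=
  exists a : 'I_r, A `<=` c @^-1` [set a].

Definition has_law d d' (T : measurableType d) (T' : measurableType d')
    (R : realType) (P : probability T R) (X : {RV P >-> T'})
    (m : set T' -> \bar R) : Prop :=
  forall A, measurable A -> distribution P X A = m A.

Arguments has_law {d d' T T' R} P X m.

Definition mutually_independent d d' (T : measurableType d)
    (T' : measurableType d') (R : realType) (P : probability T R)
    (X : nat -> {RV P >-> T'}) : Prop :=
  forall (F : {fset nat}) (A : nat -> set T'), (forall i, measurable (A i)) ->
    P (\bigcap_(i in [set` F]) (X i @^-1` A i)) =
    (\prod_(i <- F) P (X i @^-1` A i))%E.

Arguments mutually_independent {d d' T T' R} P X.

Definition iid_bernoulli d (T : measurableType d) (R : realType)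
    (P : probability T R) (p : R) (eps : nat -> {RV P >-> bool}) : Prop :=
  mutually_independent P eps /\ forall i, has_law P (eps i) (bernoulli_prob p).

Arguments iid_bernoulli {d T R} P p eps.

(* Pointwise convergence of the distribution functions at every continuity
   point of the limit distribution function. *)
Definition cvg_in_distribution d (T : measurableType d) (R : realType)
    (P : probability T R) (X : nat -> {RV P >-> R}) (m : set R -> \bar R) :
    Prop :=
  forall r : R, {for r, continuous (fun u : R => m `]-oo, u]%classic)} ->
    cdf (X k : {RV P >-> R}) r @[k --> \oo] --> m `]-oo, r]%classic.

Arguments cvg_in_distribution {d T R} P X m.

Section bernoulli_sums.
Context d (T : measurableType d) (R : realType).

Definition bool_to_real (B : {mfun T >-> bool}) : T -> R := fun t => (B t)%:R.

Lemma measurable_bool_to_real (B : {mfun T >-> bool}) :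
  measurable_fun [set: T] (bool_to_real B).
Proof. by apply: (@measurableT_comp _ _ _ _ _ _ (fun b : bool => b%:R : R)). Qed.

HB.instance Definition _ (B : {mfun T >-> bool}) :=
  isMeasurableFun.Build _ _ T R (bool_to_real B) (measurable_bool_to_real B).

Definition standardize (X : {mfun T >-> R}) (m s : R) : T -> R :=
  fun t => (X t - m) / s.

Lemma measurable_standardize (X : {mfun T >-> R}) (m s : R) :
  measurable_fun [set: T] (standardize X m s).
Proof. by apply: measurable_funM => //; exact: measurable_funB. Qed.

HB.instance Definition _ (X : {mfun T >-> R}) (m s : R) :=
  isMeasurableFun.Build _ _ T R (standardize X m s)
    (measurable_standardize X m s).

Variables (eps : nat -> {mfun T >-> bool}) (n y : nat -> nat).

Definition summand (j : nat) : T -> R :=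
  fun t => bool_to_real (eps (n j)) t * (y j)%:R.

Lemma measurable_summand (j : nat) : measurable_fun [set: T] (summand j).
Proof. by apply: measurable_funM => //; exact: measurable_bool_to_real. Qed.

HB.instance Definition _ (j : nat) :=
  isMeasurableFun.Build _ _ T R (summand j) (measurable_summand j).

Definition partial_sum (k : nat) : T -> R :=
  fun t => \sum_(j < k) summand j t.

Lemma measurable_partial_sum (k : nat) :
  measurable_fun [set: T] (partial_sum k).
Proof. by apply: measurable_sum => j; exact: measurable_summand. Qed.

HB.instance Definition _ (k : nat) :=
  isMeasurableFun.Build _ _ T R (partial_sum k) (measurable_partial_sum k).

Definition trimmed_sum (jk : nat -> nat) (k : nat) : T -> R :=
  fun t => \sum_(j < k | j != jk k :> nat) summand j t.

Lemma measurable_trimmed_sum (jk : nat -> nat) (k : nat) :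
  measurable_fun [set: T] (trimmed_sum jk k).
Proof.
rewrite (_ : trimmed_sum jk k = fun t => \sum_(j < k)
    (if j != jk k :> nat then summand j t else 0)); last first.
  by apply/funext => t; exact: big_mkcond.
by apply: measurable_sum => j; case: (_ != _) => //; exact: measurable_summand.
Qed.

HB.instance Definition _ (jk : nat -> nat) (k : nat) :=
  isMeasurableFun.Build _ _ T R (trimmed_sum jk k)
    (measurable_trimmed_sum jk k).

Definition mean_sum (P : probability T R) (k : nat) : R := 
  fine 'E_P[partial_sum k].

Definition sd_sum (P : probability T R) (k : nat) : R := 
  Num.sqrt (fine 'V_P[partial_sum k]).

End bernoulli_sums.

Arguments bool_to_real {d T R} B.
Arguments summand {d T R} eps n y j.
Arguments partial_sum {d T R} eps n y k.
Arguments trimmed_sum {d T R} eps n y jk k.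
Arguments mean_sum {d T R} eps n y P k.
Arguments sd_sum {d T R} eps n y P k.

Definition index_choice (jk : nat -> nat) : Prop :=
  forall k, (0 < k)%N -> (jk k < k)%N.

Definition argmax_choice (y jk : nat -> nat) : Prop :=
  index_choice jk /\
  forall k, (0 < k)%N -> (y (jk k) ^ 2 = \max_(j < k) y j ^ 2)%N.

Definition residual (y jk : nat -> nat) (k : nat) : nat :=
  (\sum_(j < k | j != jk k :> nat) y j ^ 2)%N.

Definition residual_max (y jk : nat -> nat) (k : nat) : nat :=
  (\max_(j < k | j != jk k :> nat) y j ^ 2)%N.

Definition trimmed_var (R : realType) (p : R) (y jk : nat -> nat) (k : nat) :
  R := p * (1 - p) * (residual y jk k)%:R.

Definition trimmed_sd (R : realType) (p : R) (y jk : nat -> nat) (k : nat) :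
  R := Num.sqrt (trimmed_var p y jk k).

Definition lindeberg_trimmed d (T : measurableType d) (R : realType)
    (P : probability T R) (p : R) (eps : nat -> {RV P >-> bool})
    (n y jk : nat -> nat) : Prop :=
  let Z j t := summand eps n y j t - p * (y j)%:R in
  forall delta : R, 0 < delta ->
    (((trimmed_var p y jk k)^-1)%:E *
     \sum_(j < k | j != jk k :> nat)
       'E_P[(fun t => Z j t ^+ 2 *
               \1_[set u | `|Z j u| > delta * trimmed_sd p y jk k] t)%R])%E
    @[k --> \oo] --> 0%E.

Arguments lindeberg_trimmed {d T R} P p eps n y jk.

(* a is a sum of some of y_0, ..., y_{k-1}; the empty sum is the value 0,
   which FS does not contain unless some term of x is 0. *)
Definition atom_in_FS (R : realType) (x y : nat -> nat) (k : nat) (a : R) :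
    Prop :=
  exists G : {set 'I_k}, a = (\sum_(j in G) y j)%N%:R /\
    (G != finset.set0 -> FS x (\sum_(j in G) y j)%N).

(* Main.v *)
Require Import Defs.
From HB Require Import structures.
From mathcomp Require Import all_boot all_order all_algebra.
From mathcomp Require Import finmap zify ring lra.
From mathcomp Require Import all_classical all_reals all_analysis measurable_realfun.

Set Implicit Arguments.
Unset Strict Implicit.
Unset Printing Implicit Defensive.

Import Order.TTheory GRing.Theory Num.Theory.
Import numFieldNormedType.Exports.

Local Open Scope classical_set_scope.
Local Open Scope ring_scope.

(* Every event involves finitely many of the variables, so all probabilities
   are finite sums over [{ffun 'I_k -> bool}].  Resampling one coordinate gives,
   for W = sum_i a_i (b_i - p),
     E[W f(W)] = p (1 - p) sum_i a_i E[f(W with b_i := 1) - f(W with b_i := 0)],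
   and the mean value theorem makes the right-hand side close to Var(W) E[f'(W)]
   when all a_i are at most delta.  For the solution f of Stein's equation
   f'(w) - w f(w) = 1{w <= r} - Phi(r), whose derivative jumps at r, this bounds
   |P(W <= r) - Phi(r)| by a constant times delta + |1 - Var(W)|, uniformly in r,
   because P(|W - r| <= delta) is itself O(delta) by the same identity applied
   to a clipped linear function.  This gives both central limit theorems.

   In the dominated regime Chebyshev's inequality replaces the normalized sum
   by the rescaled largest term.  If the removed term is not negligible, the
   distribution function of the full sum is close to that of Z + a_k (B - p);
   a normal limit forces a_k to be bounded, and at a cluster point a > 0 of a_k
   the mixture of two normal densities would be a normal density. *)

(** * Finite expectations over Bernoulli outcomes *)

Section bernoulli_mean.
Context (R : realFieldType) (p : R) (hp : 0 < p < 1) (I : finType).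
Let p_gt0 : 0 < p. Proof. by case/andP: hp. Qed.
Let p_lt1 : p < 1. Proof. by case/andP: hp. Qed.
Implicit Types (b : {ffun I -> bool}) (g h : {ffun I -> bool} -> R).
Implicit Types (a : I -> R) (f : R -> R).

Definition bern_weight b : R := \prod_i (if b i then p else 1 - p).

Definition bern_mean g : R := \sum_b bern_weight b * g b.

Definition upd b (i : I) (v : bool) : {ffun I -> bool} :=
  [ffun j => if j == i then v else b j].

Lemma bern_weight_ge0 b : 0 <= bern_weight b.
Proof.
by apply: prodr_ge0 => i _; have := p_gt0; have := p_lt1; case: (b i) => /=; lra.
Qed.

Lemma sum_bern_weight : \sum_b bern_weight b = 1.
Proof.
rewrite -(bigA_distr_bigA (fun (_ : I) (v : bool) => if v then p else 1 - p)).
by rewrite big1 // => i _; rewrite big_bool /= addrC subrK.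
Qed.

Lemma bern_mean_cst (c : R) : bern_mean (fun=> c) = c.
Proof. by rewrite /bern_mean -mulr_suml sum_bern_weight mul1r. Qed.

Lemma eq_bern_mean g h : g =1 h -> bern_mean g = bern_mean h.
Proof. by move=> gh; apply: eq_bigr => b _; rewrite gh. Qed.

Lemma bern_meanD g h :
  bern_mean (fun b => g b + h b) = bern_mean g + bern_mean h.
Proof. by rewrite -big_split; apply: eq_bigr => b _; rewrite mulrDr. Qed.

Lemma bern_meanZ (c : R) g : bern_mean (fun b => c * g b) = c * bern_mean g.
Proof. by rewrite /bern_mean mulr_sumr; apply: eq_bigr => b _; ring. Qed.

Lemma bern_meanB g h :
  bern_mean (fun b => g b - h b) = bern_mean g - bern_mean h.
Proof.
by rewrite -sumrB; apply: eq_bigr => b _; rewrite mulrBr.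
Qed.

Lemma bern_mean_sum (J : Type) (s : seq J) (Q : pred J)
    (G : J -> {ffun I -> bool} -> R) :
  bern_mean (fun b => \sum_(j <- s | Q j) G j b) =
  \sum_(j <- s | Q j) bern_mean (G j).
Proof.
by rewrite exchange_big /=; apply: eq_bigr => b _; rewrite mulr_sumr.
Qed.

Lemma ler_bern_mean g h : (forall b, g b <= h b) -> bern_mean g <= bern_mean h.
Proof.
by move=> gh; apply: ler_sum => b _; rewrite ler_wpM2l// bern_weight_ge0.
Qed.

Lemma ler_norm_bern_mean g : `|bern_mean g| <= bern_mean (fun b => `|g b|).
Proof.
apply: le_trans (ler_norm_sum _ _ _) _; apply: ler_sum => b _.
by rewrite normrM ger0_norm// bern_weight_ge0.
Qed.

Lemma bern_weight_upd b i v :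
  bern_weight (upd b i v) =
  (if v then p else 1 - p) * \prod_(j | j != i) (if b j then p else 1 - p).
Proof.
rewrite /bern_weight (bigD1 i)//= ffunE eqxx; congr (_ * _).
by apply: eq_bigr => j ji; rewrite ffunE (negbTE ji).
Qed.

Lemma upd_id b i : upd b i (b i) = b.
Proof. by apply/ffunP => j; rewrite ffunE; case: eqP => // ->. Qed.

Lemma upd_upd b i v w : upd (upd b i v) i w = upd b i w.
Proof. by apply/ffunP => j; rewrite !ffunE; case: eqP. Qed.

Lemma upd_at b i v : upd b i v i = v.
Proof. by rewrite ffunE eqxx. Qed.

(** Switching coordinate [i] off is a bijection from the outcomes with [b i] true onto the others,
    so the sum runs over pairs. *)
Lemma sum_upd g i :
  \sum_b g b = \sum_(b : {ffun I -> bool} | b i) (g b + g (upd b i false)).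
Proof.
rewrite (bigID (fun b => b i)) big_split /=; congr (_ + _).
rewrite (reindex_onto (fun b => upd b i false) (fun b => upd b i true)) /=.
  apply: eq_bigl => b; rewrite upd_at upd_upd /=.
  apply/eqP/idP => [<-|bi]; first by rewrite upd_at.
  by rewrite -[in RHS](upd_id b i) bi.
by move=> b /negbTE bi; rewrite upd_upd -[in RHS](upd_id b i) bi.
Qed.

Lemma bern_mean_resample g i :
  bern_mean g =
  p * bern_mean (fun b => g (upd b i true)) +
  (1 - p) * bern_mean (fun b => g (upd b i false)).
Proof.
rewrite -!bern_meanZ -bern_meanD /bern_mean (sum_upd _ i) [RHS](sum_upd _ i).
apply: eq_bigr => b bi; rewrite !upd_upd.
have -> : upd b i true = b by rewrite -[RHS](upd_id b i) bi.
have -> : bern_weight b = p * \prod_(j | j != i) (if b j then p else 1 - p).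
  by rewrite -[in LHS](upd_id b i) bern_weight_upd bi.
by rewrite bern_weight_upd; ring.
Qed.

(** Given the other coordinates, the centred factor is [1 - p] with probability [p] and [- p] with
    probability [1 - p]. Both values of [g] thus carry the coefficient [p * (1 - p)], with opposite
    signs. *)
Lemma bern_mean_center g i :
  bern_mean (fun b => ((b i)%:R - p) * g b) =
  p * (1 - p) * bern_mean (fun b => g (upd b i true) - g (upd b i false)).
Proof.
rewrite (bern_mean_resample _ i) bern_meanB.
under eq_bern_mean do rewrite upd_at.
under [X in _ + _ * X]eq_bern_mean do rewrite upd_at.
by rewrite !bern_meanZ /=; ring.
Qed.

Definition bern_sum a b : R := \sum_i a i * ((b i)%:R - p).

Lemma bern_sum_upd a b i v :
  bern_sum a (upd b i v) = bern_sum a b + a i * (v%:R - (b i)%:R).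
Proof.
rewrite /bern_sum (bigD1 i)//= [in RHS](bigD1 i)//= upd_at.
rewrite [in LHS](eq_bigr (fun j => a j * ((b j)%:R - p))); first by ring.
by move=> j ji; rewrite ffunE (negbTE ji).
Qed.

(** Discrete integration by parts: expand the first factor and centre one coordinate at a time. *)
Lemma bern_mean_sum_mul a f :
  bern_mean (fun b => bern_sum a b * f (bern_sum a b)) =
  \sum_i p * (1 - p) * bern_mean (fun b => a i *
    (f (bern_sum a (upd b i true)) - f (bern_sum a (upd b i false)))).
Proof.
under eq_bern_mean do rewrite {1}/bern_sum mulr_suml.
rewrite bern_mean_sum; apply: eq_bigr => i _.
under eq_bern_mean do rewrite -mulrA.
rewrite !bern_meanZ [RHS]mulrCA; congr (_ * _).
exact: (bern_mean_center (fun b => f (bern_sum a b))).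
Qed.

Definition bern_sum_var a : R := p * (1 - p) * \sum_i a i ^+ 2.

Lemma bern_sum_var_ge0 a : 0 <= bern_sum_var a.
Proof.
rewrite mulr_ge0 ?sumr_ge0//; first by have := p_gt0; have := p_lt1; nra.
by move=> i _; exact: sqr_ge0.
Qed.

Lemma bern_mean_sum0 a : bern_mean (bern_sum a) = 0.
Proof.
rewrite (@eq_bern_mean _ (fun b => bern_sum a b * (fun=> 1) (bern_sum a b))).
  rewrite (bern_mean_sum_mul a (fun=> 1)) big1// => i _.
  by under eq_bern_mean do rewrite subrr mulr0; rewrite bern_mean_cst mulr0.
by move=> b; rewrite mulr1.
Qed.

Lemma bern_mean_sum_sqr a :
  bern_mean (fun b => bern_sum a b ^+ 2) = bern_sum_var a.
Proof.
under eq_bern_mean do rewrite expr2.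
rewrite (bern_mean_sum_mul a id) /bern_sum_var mulr_sumr.
apply: eq_bigr => i _; congr (_ * _).
(* Raising coordinate [i] from 0 to 1 changes the sum by exactly [a i]. *)
rewrite -[RHS](bern_mean_cst); apply: eq_bern_mean => b.
by rewrite !bern_sum_upd /=; ring.
Qed.

Lemma bern_mean_norm_sum a :
  bern_mean (fun b => `|bern_sum a b|) <= (1 + bern_sum_var a) / 2.
Proof.
have -> : 1 + bern_sum_var a = bern_mean (fun b => 1 + bern_sum a b ^+ 2).
  by rewrite bern_meanD bern_mean_cst bern_mean_sum_sqr.
rewrite mulrC -bern_meanZ; apply: ler_bern_mean => b /=.
rewrite -(real_normK (num_real (bern_sum a b))).
by have := sqr_ge0 (`|bern_sum a b| - 1); lra.
Qed.

Lemma bern_chebyshev a (e : R) : 0 < e ->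
  bern_mean (fun b => (e <= `|bern_sum a b|)%R%:R) <= bern_sum_var a / e ^+ 2.
Proof.
move=> e0; rewrite -bern_mean_sum_sqr mulrC -bern_meanZ.
apply: ler_bern_mean => b /=; rewrite ler_pdivlMl ?exprn_gt0//.
rewrite -(real_normK (num_real (bern_sum a b))).
by case: (lerP e) => h; rewrite ?mulr1 ?mulr0 ?sqr_ge0// lerXn2r ?nnegrE// ltW.
Qed.

End bernoulli_mean.

(** * Stein's identity with error terms, and concentration *)

Section stein_estimate.
Context (R : realFieldType) (p : R) (hp : 0 < p < 1) (I : finType).
Variables (a : I -> R) (delta : R).
Let p_gt0 : 0 < p. Proof. by case/andP: hp. Qed.
Let p_lt1 : p < 1. Proof. by case/andP: hp. Qed.
Hypothesis (a_bnd : forall i, 0 <= a i <= delta).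
Let W := bern_sum p a.
Let E := @bern_mean R p I.

Let updW b i : [/\ W (upd b i false) <= W b, W b <= W (upd b i true),
  W (upd b i true) - W (upd b i false) = a i &
  W (upd b i true) - W (upd b i false) <= delta].
Proof.
have /andP[a0 ad] := a_bnd i.
by rewrite /W !bern_sum_upd; case: (b i) => /=; split; lra.
Qed.

Let sum_varM (m : R) :
  bern_sum_var p a * m = \sum_i p * (1 - p) * (a i ^+ 2 * m).
Proof. by rewrite -mulr_sumr -mulr_suml mulrA. Qed.

(** Here [u] and [v] are the values of the sum with coordinate [i] set to 0 and 1, and [w] is its
    actual value, which lies between them. As [v - u] equals [a i], the factor [a i] in front turns
    the linear term into the [a i ^+ 2] of the variance. *)
Lemma stein_estimate (f g K : R -> R) :
  (forall u w v, u <= w -> w <= v -> v - u <= delta ->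
     `|f v - f u - (v - u) * g w| <= (v - u) * K w) ->
  `|E (fun b => W b * f (W b)) - bern_sum_var p a * E (fun b => g (W b))| <=
  bern_sum_var p a * E (fun b => K (W b)).
Proof.
move=> fgK; rewrite /E /W bern_mean_sum_mul -/W.
rewrite !sum_varM -sumrB.
apply: le_trans (ler_norm_sum _ _ _) _; apply: ler_sum => i _.
rewrite -mulrBr normrM ger0_norm; last by have := p_gt0; have := p_lt1; nra.
rewrite ler_wpM2l//; first by have := p_gt0; have := p_lt1; nra.
rewrite -!bern_meanZ -bern_meanB.
apply: le_trans (ler_norm_bern_mean hp _) _; apply: (ler_bern_mean hp) => b /=.
have [h1 h2 h3 h4] := updW b i; have := fgK _ _ _ h1 h2 h4; rewrite h3 => H.
have /andP[a0 _] := a_bnd i.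
rewrite expr2 -!mulrA -mulrBr normrM ger0_norm//.
by rewrite ler_wpM2l.
Qed.

(* The test function is linear of slope 1 within [2 * delta] of [r], constant
   elsewhere, and bounded by [2 * delta]. *)
Lemma bern_concentration (r : R) : 0 <= delta ->
  bern_sum_var p a * E (fun b => (`|W b - r| <= delta)%R%:R) <=
  delta * (1 + bern_sum_var p a).
Proof.
move=> d0.
pose f (w : R) : R := Num.min (2 * delta) (Num.max (- (2 * delta)) (w - r)).
have fbnd w : `|f w| <= 2 * delta.
  rewrite /f ler_norml le_min ge_min le_max !lexx /=; lra.
have fmono u v : u <= v -> f u <= f v.
  move=> uv; rewrite /f /Num.min /Num.max.
  by do ! case: ifPn; rewrite -?leNgt; lra.
(* If [w] is within [delta] of [r], both endpoints lie within [2 * delta], where [f] has slope 1;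
   otherwise monotonicity suffices. *)
have fslope u w v : u <= w -> w <= v -> v - u <= delta ->
    (v - u) * (`|w - r| <= delta)%R%:R <= f v - f u.
  move=> uw wv vu; case: (lerP `|w - r| delta) => [|_]; last first.
    by rewrite mulr0 subr_ge0 fmono// (le_trans uw).
  rewrite ler_norml mulr1 => /andP[h1 h2]; rewrite /f /Num.min /Num.max.
  by do ! case: ifPn; rewrite -?leNgt; lra.
have lb : bern_sum_var p a * E (fun b => (`|W b - r| <= delta)%R%:R) <=
    E (fun b => W b * f (W b)).
  rewrite /E /W bern_mean_sum_mul -/W sum_varM.
  apply: ler_sum => i _; rewrite ler_wpM2l//; first by have := p_gt0; have := p_lt1; nra.
  rewrite -bern_meanZ; apply: (ler_bern_mean hp) => b /=.
  have [h1 h2 h3 h4] := updW b i; have := fslope _ _ _ h1 h2 h4; rewrite h3 => H.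
  have /andP[a0 _] := a_bnd i.
  by rewrite expr2 -mulrA ler_wpM2l.
apply: (le_trans lb).
have h := bern_mean_norm_sum hp a.
apply: (@le_trans _ _ (2 * delta * bern_mean p (fun b => `|W b|))).
  rewrite -bern_meanZ; apply: (ler_bern_mean hp) => b /=.
  by rewrite (le_trans (ler_norm _))// normrM mulrC ler_wpM2r.
rewrite /W; apply: (@le_trans _ _ (2 * delta * ((1 + bern_sum_var p a) / 2))).
  by rewrite ler_wpM2l//; lra.
by lra.
Qed.

End stein_estimate.

(** * The normal distribution function and Stein's equation *)

Section normal_cdf.
Context (R : realType).
Local Notation mu := (@lebesgue_measure R).

Definition normal_cdf (m s : R) (r : R) : R := fine (normal_prob m s `]-oo, r]).

Lemma is_derive_normal_cdf (m s r : R) : s != 0 ->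
  is_derive r 1 (normal_cdf m s) (normal_pdf m s r).
Proof.
move=> s0.
(* The upper end [r + 1] makes [r] interior to the domain of integration. *)
have r1 : r < r + 1 by rewrite ltrDl.
have int1 : mu.-integrable [set` Interval -oo%O (BRight (r + 1))]
    (EFin \o normal_pdf m s).
  by apply: (integrableS measurableT) => //; exact: integrable_normal_pdf.
have [|d1 <-] := continuous_FTC1 r1 int1 _ (@continuous_normal_pdf R m s s0 r).
  exact: ltNyr.
by rewrite derive1E; exact: derivableP.
Qed.

Lemma normal_cdfE (m s r : R) :
  normal_prob m s `]-oo, r] = (normal_cdf m s r)%:E.
Proof. by rewrite fineK// fin_num_measure. Qed.

Lemma normal_cdf_ge0 (m s r : R) : 0 <= normal_cdf m s r.
Proof. exact: fine_ge0. Qed.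

Lemma normal_cdf_le1 (m s r : R) : normal_cdf m s r <= 1.
Proof. by rewrite -lee_fin -normal_cdfE probability_le1. Qed.

Lemma normal_pdf_gt0 (m s r : R) : s != 0 -> 0 < normal_pdf m s r.
Proof. by move=> s0; rewrite normal_pdfE// mulr_gt0 ?expR_gt0 ?normal_peak_gt0. Qed.

Lemma continuous_is_derive (f df : R -> R) :
  (forall x : R, is_derive x 1 f (df x)) -> continuous f.
Proof.
by move=> h x; apply/differentiable_continuous/derivable1_diffP; case: (h x).
Qed.

Lemma is_derive_MVT (f df : R -> R) (u v : R) : u <= v ->
  (forall x : R, is_derive x 1 f (df x)) ->
  exists2 c, u <= c <= v & f v - f u = df c * (v - u).
Proof.
move=> uv h; have [|c] := MVT_segment uv (fun x _ => h x).
  exact/continuous_subspaceT/(continuous_is_derive h).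
by rewrite in_itv /= => cuv E; exists c.
Qed.

Lemma normal_cdf_lt (m s u v : R) : s != 0 -> u < v ->
  normal_cdf m s u < normal_cdf m s v.
Proof.
move=> s0 uv; rewrite -subr_gt0.
have [c _ ->] := is_derive_MVT (ltW uv) (fun r => is_derive_normal_cdf m r s0).
by rewrite mulr_gt0 ?normal_pdf_gt0// subr_gt0.
Qed.

(** Under the normal law itself the identity is a random variable whose distribution function is
    [normal_cdf]; the limits at infinity come from this. *)
Let idR : measurableTypeR R -> R := idfun.

HB.instance Definition _ :=
  @isMeasurableFun.Build _ _ _ _ idR (@measurable_id _ _ setT).

Lemma normal_cdf_cvgNy (m s : R) : normal_cdf m s r @[r --> -oo] --> (0 : R).
Proof.
have := @cvg_cdfNy0 _ _ R (normal_prob m s) idR.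
by move=> /fine_cvg.
Qed.

Lemma normal_cdf_cvgy (m s : R) : normal_cdf m s r @[r --> +oo] --> (1 : R).
Proof.
have := @cvg_cdfy1 _ _ R (normal_prob m s) idR.
by move=> /fine_cvg.
Qed.

Lemma normal_cdf_small (m s e : R) : 0 < e -> exists v, normal_cdf m s v < e.
Proof.
move=> e0; apply: (@filter_ex _ (-oo : set_system R)).
by apply: (cvgr_lt (0 : R) (normal_cdf_cvgNy m s)).
Qed.

Lemma normal_cdf_large (m s e : R) :
  0 < e -> exists v, 1 - normal_cdf m s v < e.
Proof.
move=> e0.
have [v hv] : exists v, 1 - e < normal_cdf m s v.
  apply: (@filter_ex _ (+oo : set_system R)).
  by apply: (cvgr_gt (1 : R) (normal_cdf_cvgy m s)) => //; rewrite gtrBl.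
by exists v; lra.
Qed.

Lemma is_derive_normal_pdf01 (r : R) :
  is_derive r 1 (normal_pdf 0 1) (- r * normal_pdf 0 1 r).
Proof.
have -> : normal_pdf 0 1 = normal_peak 1 \*: (expR \o (-2^-1 \*: (@idfun R ^+ 2))).
  apply/funext => x; rewrite normal_pdfE ?oner_neq0// /normal_fun /= subr0.
  congr (_ * expR _); rewrite expr1n.
  have -> : (@idfun R ^+ 2) x = x * x by [].
  by rewrite /GRing.scale /=; field.
apply: is_derive_eq.
rewrite /GRing.scale /= expr1 /=; set E := expR _.
by rewrite -[_ *: E]/(_ * E); field.
Qed.

End normal_cdf.

(** * Regularity of solutions of Stein's equation away from the kink *)

Section stein_ode.
Context (R : realType) (h : R -> R) (c C u v : R).
Hypotheses (dh : forall x : R, is_derive x 1 h (x * h x + c)) (c1 : `|c| <= 1).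
Hypotheses (uv : u <= v).
Hypothesis h_bnd : forall x, u <= x <= v -> `|h x| <= C /\ `|x * h x| <= 1.

(** The equation bounds the derivative by [1 + 1]. The bounds on [h] are assumed on one interval
    only, because each branch of Stein's solution is controlled on one side of [r]. *)
Lemma stein_ode_lipschitz x y : u <= x -> x <= y -> y <= v ->
  `|h y - h x| <= 2 * (y - x).
Proof.
move=> ux xy yv; have [z /andP[xz zy] ->] := is_derive_MVT xy dh.
rewrite normrM (ger0_norm (x := y - x)) ?subr_ge0// ler_wpM2r ?subr_ge0//.
have [|_ zh] := h_bnd (x := z); first by rewrite (le_trans ux) ?(le_trans zy).
by rewrite (le_trans (ler_normD _ _))// (le_trans (lerD zh c1))//; lra.
Qed.

Lemma stein_ode_slope w delta : u <= w <= v -> v - u <= delta -> delta <= 1 ->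
  `|h v - h u - (v - u) * (w * h w + c)| <=
  (v - u) * (delta * (C + 2 * (`|w| + 1))).
Proof.
move=> /andP[uw wv] vud d1; have [z /andP[uz zv] ->] := is_derive_MVT uv dh.
have -> : (z * h z + c) * (v - u) - (v - u) * (w * h w + c) =
  (v - u) * ((z - w) * h w + z * (h z - h w)) by ring.
rewrite normrM (ger0_norm (x := v - u)) ?subr_ge0// ler_wpM2l ?subr_ge0//.
have zw1 : - delta <= z - w by lra.
have zw2 : z - w <= delta by lra.
have zw : `|z - w| <= delta by rewrite ler_norml zw1 zw2.
have hzw : `|h z - h w| <= 2 * delta.
  have [wz|/ltW zw'] := lerP w z.
    by rewrite (le_trans (stein_ode_lipschitz _ _ _))//; lra.
  rewrite distrC (le_trans (stein_ode_lipschitz _ _ _))//; lra.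
have [|hw _] := h_bnd (x := w); first by rewrite uw.
have zb : `|z| <= `|w| + 1.
  rewrite -[z](subrK w) addrC (le_trans (ler_normD _ _))// lerD2l.
  exact: le_trans zw d1.
rewrite (le_trans (ler_normD _ _))// !normrM mulrDr lerD//.
  by rewrite ler_pM.
by rewrite mulrC mulrA [delta * 2]mulrC ler_pM.
Qed.

End stein_ode.

Section stein_solution.
Context (R : realType).
Local Notation F := (@normal_cdf R 0 1).
Local Notation phi := (@normal_pdf R 0 1).

Let one0 : (1 : R) != 0. Proof. exact: oner_neq0. Qed.
Let phi_gt0 r : 0 < phi r. Proof. exact: normal_pdf_gt0. Qed.
Let phi_neq0 r : phi r != 0. Proof. by rewrite gt_eqF. Qed.
Let dF (r : R) : is_derive r 1 F (phi r).
Proof. exact: is_derive_normal_cdf. Qed.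
Let dphi (r : R) : is_derive r 1 phi (- r * phi r).
Proof. exact: is_derive_normal_pdf01. Qed.

Let F_le u v : u <= v -> F u <= F v.
Proof.
by rewrite le_eqVlt => /predU1P[->//|uv]; rewrite ltW// normal_cdf_lt.
Qed.

(* [x |-> phi x + w * F x] has derivative [(w - x) * phi x], hence a maximum
   at [w]. *)
Let phi_wF_max w v : phi v + w * F v <= phi w + w * F w.
Proof.
pose k : R -> R := phi + w \*: F.
have dk (x : R) : is_derive x 1 k ((w - x) * phi x).
  apply: (is_derive_eq (is_deriveD (dphi x) (is_deriveZ w (dF x)))).
  by rewrite /GRing.scale /=; ring.
change (k v <= k w).
have [vw|/ltW wv] := lerP v w; rewrite -subr_ge0.
  have [c /andP[_ cw] ->] := is_derive_MVT vw dk.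
  by rewrite mulr_ge0 ?subr_ge0// mulr_ge0 ?subr_ge0// ltW.
have [c /andP[wc _]] := is_derive_MVT wv dk.
move=> E; rewrite -oppr_le0 opprB E.
by rewrite mulr_le0_ge0 ?subr_ge0// mulr_le0_ge0 ?subr_le0// ltW.
Qed.

(** Let [v] tend to minus infinity in [phi_wF_max]; a [v] with [F v] below [e / (1 - w)] replaces
    the limit. *)
Lemma mills_ratio_neg w : w <= 0 -> - w * F w <= phi w.
Proof.
move=> w0; apply/ler_addgt0Pr => e e0.
have d0 : 0 < e / (1 - w) by rewrite divr_gt0//; lra.
have [v] := normal_cdf_small 0 1 d0; rewrite ltr_pdivlMr; last by lra.
have := phi_wF_max w v; have := phi_gt0 v; have := normal_cdf_ge0 0 1 v.
by nra.
Qed.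

(** The same argument with [v] tending to plus infinity. *)
Lemma mills_ratio_pos w : 0 <= w -> w * (1 - F w) <= phi w.
Proof.
move=> w0; apply/ler_addgt0Pr => e e0.
have d0 : 0 < e / (1 + w) by rewrite divr_gt0//; lra.
have [v] := normal_cdf_large 0 1 d0; rewrite ltr_pdivlMr; last by lra.
have := phi_wF_max w v; have := phi_gt0 v; have := normal_cdf_le1 0 1 v.
by nra.
Qed.

Definition stein_const : R := 1 + (phi 1)^-1.

Let phi_le_1 w : -1 <= w <= 1 -> phi 1 <= phi w.
Proof.
move=> w1; rewrite !normal_pdfE// ler_wpM2l ?normal_peak_ge0// ler_expR.
rewrite !subr0 !expr1n; have := w1; rewrite -ler_norml => w2.
suff : w ^+ 2 <= 1 by lra.
by rewrite -(real_normK (num_real w)) exprn_ile1.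
Qed.

(** For [|w| <= 1] the density is at least [phi 1]; beyond that, $q \le |w| q \le \varphi(w)$ bounds
    the quotient by 1. [stein_const] adds the two bounds. *)
Let tail_bound q w : 0 <= q <= 1 -> `|w| * q <= phi w ->
  `|q / phi w| <= stein_const /\ `|w * (q / phi w)| <= 1.
Proof.
move=> /andP[q0 q1] wq; split; last first.
  by rewrite mulrA !normrM normfV (ger0_norm q0) (gtr0_norm (phi_gt0 w))
    ler_pdivrMr// mul1r.
rewrite normrM normfV (ger0_norm q0) (gtr0_norm (phi_gt0 w)).
rewrite /stein_const; have [w1|w1] := lerP `|w| 1.
  apply: (@le_trans _ _ (phi 1)^-1); last by lra.
  have pw : 0 <= (phi w)^-1 by rewrite invr_ge0 ltW.
  rewrite (le_trans (ler_piMl pw q1))//.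
  by rewrite lef_pV2 ?posrE// phi_le_1// -ler_norml.
apply: (@le_trans _ _ 1); last by rewrite lerDl invr_ge0 ltW.
rewrite ler_pdivrMr// mul1r (le_trans _ wq)//.
by rewrite -[leLHS]mul1r ler_wpM2r// ltW.
Qed.

Variable r : R.

(** The two branches of Stein's solution: [f1] solves $f' = wf + 1 - F(r)$ and is used left of [r],
    [f2] solves $f' = wf - F(r)$ and is used right of it. *)
Let f1 w := (1 - F r) * (F w / phi w).
Let f2 w := F r * ((1 - F w) / phi w).

Let f1_bound w : w <= r -> `|f1 w| <= stein_const /\ `|w * f1 w| <= 1.
Proof.
move=> wr; have Fwr := F_le wr; have := normal_cdf_le1 0 1 r.
have := normal_cdf_ge0 0 1 w => F0 F1.
rewrite /f1 mulrA; apply: tail_bound.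
  by apply/andP; split; nra.
(* For [w >= 0], $(1-F(r))F(w) \le 1-F(w)$ because [w <= r]; for [w <= 0] the product is at most
   $F(w)$. The Mills bound of matching sign applies. *)
have [w0|/ltW w0] := lerP 0 w.
  rewrite ger0_norm// (le_trans _ (mills_ratio_pos w0))// ler_wpM2l//; nra.
rewrite ler0_norm// (le_trans _ (mills_ratio_neg w0))// ler_wpM2l ?oppr_ge0//; nra.
Qed.

Let f2_bound w : r <= w -> `|f2 w| <= stein_const /\ `|w * f2 w| <= 1.
Proof.
move=> wr; have Fwr := F_le wr; have := normal_cdf_le1 0 1 w.
have := normal_cdf_ge0 0 1 r => F0 F1.
rewrite /f2 mulrA; apply: tail_bound.
  by apply/andP; split; nra.
(* Mirror image: $F(r)(1-F(w))$ is at most $1-F(w)$, and at most $F(w)$ because [r <= w]. *)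
have [w0|/ltW w0] := lerP 0 w.
  rewrite ger0_norm// (le_trans _ (mills_ratio_pos w0))// ler_wpM2l//; nra.
rewrite ler0_norm// (le_trans _ (mills_ratio_neg w0))// ler_wpM2l ?oppr_ge0//; nra.
Qed.

Let df1 (w : R) : is_derive w 1 f1 (w * f1 w + (1 - F r)).
Proof.
rewrite (_ : f1 = (1 - F r) \*: (F * (fun y => (phi y)^-1))); last exact/funext.
have dV := is_deriveV (phi_neq0 w) (dphi w).
apply: (is_derive_eq (is_deriveZ (1 - F r) (is_deriveM (dF w) dV))).
rewrite /GRing.scale /= -[RHS]/(w * ((1 - F r) * (F w / phi w)) + (1 - F r)).
by field.
Qed.

Let df2 (w : R) : is_derive w 1 f2 (w * f2 w - F r).
Proof.
rewrite (_ : f2 = F r \*: ((cst 1 - F) * (fun y => (phi y)^-1))); last exact/funext.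
have dV := is_deriveV (phi_neq0 w) (dphi w).
have dG := is_deriveB (is_derive_cst (1 : R) w 1) (dF w).
apply: (is_derive_eq (is_deriveZ (F r) (is_deriveM dG dV))).
rewrite /GRing.scale /= -[RHS]/(w * (F r * ((1 - F w) / phi w)) - F r).
by rewrite -[(cst 1 - F) w]/(1 - F w); field.
Qed.

(* The bounded solution of [f' w = w * f w + (w <= r) - F r]; at the kink [r] this
   formula gives the left derivative. *)
Definition stein_sol w := if w <= r then f1 w else f2 w.

Lemma stein_sol_bound w : `|w * stein_sol w + (w <= r)%R%:R - F r| <= 2.
Proof.
have F0 := normal_cdf_ge0 0 1 r; have F1 := normal_cdf_le1 0 1 r.
rewrite /stein_sol; have [wr|/ltW wr] := lerP w r.
  have [_] := f1_bound wr; rewrite !ler_norml => /andP[? ?].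
  by apply/andP; split => /=; lra.
have [_] := f2_bound wr; rewrite !ler_norml => /andP[? ?].
by apply/andP; split => /=; lra.
Qed.

Lemma stein_sol_slope delta u w v :
    delta <= 1 -> u <= w -> w <= v -> v - u <= delta ->
  `|stein_sol v - stein_sol u -
    (v - u) * (w * stein_sol w + (w <= r)%R%:R - F r)| <=
  (v - u) * (4 * (`|w - r| <= delta)%R%:R +
             delta * (stein_const + 2 * (`|w| + 1))).
Proof.
move=> d1 uw wv vud; have uv := le_trans uw wv.
have F0 := normal_cdf_ge0 0 1 r; have F1 := normal_cdf_le1 0 1 r.
have Cw : 0 <= delta * (stein_const + 2 * (`|w| + 1)).
  rewrite mulr_ge0//; first by rewrite (le_trans _ vud)// subr_ge0.
  by rewrite addr_ge0// ?mulr_ge0 ?addr_ge0// invr_ge0 ltW.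
have [vr|rv] := lerP v r.
  have [ur wr] : u <= r /\ w <= r by split; lra.
  rewrite /stein_sol vr ur wr -[_ + _ - F r]addrA.
  have c1 : `|1 - F r| <= 1 by rewrite ler_norml; apply/andP; split; lra.
  apply: (le_trans (stein_ode_slope df1 c1 uv _ _ vud d1)).
  - by move=> x /andP[_ xv]; apply: f1_bound; exact: le_trans vr.
  - by rewrite uw.
  - by rewrite ler_wpM2l ?subr_ge0// lerDr mulr_ge0.
have [ur|ru] := lerP u r; last first.
  have rw : r < w by lra.
  rewrite /stein_sol !(leNgt _ r) rv ru rw /= mulr0n addr0.
  have c1 : `|- F r| <= 1 by rewrite normrN ler_norml; apply/andP; split; lra.
  apply: (le_trans (stein_ode_slope df2 c1 uv _ _ vud d1)).
  - by move=> x /andP[ux _]; apply: f2_bound; rewrite (le_trans (ltW ru)).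
  - by rewrite uw.
  - by rewrite ler_wpM2l ?subr_ge0// lerDr mulr_ge0.
(* Now [u <= r < v], so the kink is inside the interval and the indicator equals 1. The branches
   agree at [r]; splitting there bounds the increment by [2 * (v - u)]. The linear term costs as
   much again, whence the constant 4. *)
have -> : `|w - r| <= delta by rewrite ler_norml; apply/andP; split; lra.
have Ewr : f1 r = f2 r by rewrite /f1 /f2; ring.
have H1 : `|f1 r - f1 u| <= 2 * (r - u).
  have c1 : `|1 - F r| <= 1 by rewrite ler_norml; apply/andP; split; lra.
  apply: (stein_ode_lipschitz (u := u) (v := r) df1 c1 (C := stein_const)) => //.
  by move=> x /andP[_ xv]; apply: f1_bound.
have H2 : `|f2 v - f2 r| <= 2 * (v - r).
  have c1 : `|- F r| <= 1 by rewrite normrN ler_norml; apply/andP; split; lra.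
  apply: (stein_ode_lipschitz (u := r) (v := v) df2 c1 (C := stein_const)) => //; last exact: ltW.
  by move=> x /andP[ux _]; apply: f2_bound.
rewrite (le_trans (ler_normB _ _))// normrM (ger0_norm (x := v - u)) ?subr_ge0//.
have Hg := stein_sol_bound w.
have H3 : `|stein_sol v - stein_sol u| <= 2 * (v - u).
  rewrite /stein_sol ur (leNgt v r) rv /=.
  rewrite (_ : f2 v - f1 u = (f2 v - f2 r) + (f1 r - f1 u)); last by rewrite Ewr; ring.
  by rewrite (le_trans (ler_normD _ _))//; lra.
rewrite mulr1 mulrDr (le_trans (lerD H3 (ler_wpM2l _ Hg))) ?subr_ge0//.
have vu0 : 0 <= v - u by rewrite subr_ge0.
by have := mulr_ge0 vu0 Cw; lra.
Qed.

End stein_solution.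

(** * A uniform error bound for the normal approximation *)

Section berry_esseen.
Context (R : realType) (p : R) (hp : 0 < p < 1).
Local Notation F := (@normal_cdf R 0 1).

Lemma bernoulli_berry_esseen : exists2 C : R, 0 < C &
  forall (I : finType) (a : I -> R) (delta r : R),
    0 <= delta <= 1 -> (forall i, 0 <= a i <= delta) -> bern_sum_var p a <= 2 ->
    `|bern_mean p (fun b => (bern_sum p a b <= r)%R%:R) - F r| <=
    C * (delta + `|1 - bern_sum_var p a|).
Proof.
(* With variance at most 2, the kink costs [4 * (3 * delta)] and the smooth part
   [2 * (stein_const R + 5) * delta]; this constant exceeds their sum and also the factor 2 of
   [|1 - V|]. *)
exists (stein_const R * 2 + 24).
  by rewrite ltr_wpDl// mulr_ge0// addr_ge0// invr_ge0 ltW// normal_pdf_gt0.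
move=> I a delta r /andP[d0 d1] a_bnd; set V := bern_sum_var p a => V2.
have V0 : 0 <= V by exact: bern_sum_var_ge0.
pose W := bern_sum p a; pose f := stein_sol r.
pose g w := w * f w + (w <= r)%R%:R - F r.
pose K w : R := 4 * (`|w - r| <= delta)%R%:R +
             delta * (stein_const R + 2 * (`|w| + 1)).
have C0 : 0 <= stein_const R by rewrite addr_ge0// invr_ge0 ltW// normal_pdf_gt0.
have H := @stein_estimate _ _ hp I a delta a_bnd f g K.
have {}H := H (fun u w v uw wv vu => stein_sol_slope r d1 uw wv vu).
(* Expectation of Stein's equation, with [V] times the mean of [g] subtracted and added back. *)
have -> : bern_mean p (fun b => (bern_sum p a b <= r)%R%:R) - F r =
    (1 - V) * bern_mean p (fun b => g (W b)) -
    (bern_mean p (fun b => W b * f (W b)) - V * bern_mean p (fun b => g (W b))).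
  rewrite (_ : bern_mean p (fun b => g (W b)) =
    bern_mean p (fun b => W b * f (W b)) +
    bern_mean p (fun b => (W b <= r)%R%:R) - F r); first by ring.
  by rewrite /g bern_meanB bern_meanD bern_mean_cst.
rewrite (le_trans (ler_normB _ _))// normrM.
have Hg : `|bern_mean p (fun b => g (W b))| <= 2.
  rewrite (le_trans (ler_norm_bern_mean hp _))//.
  rewrite -[leRHS](@bern_mean_cst R p I); apply: (ler_bern_mean hp) => b.
  exact: stein_sol_bound.
have HK : V * bern_mean p (fun b => K (W b)) <= (stein_const R * 2 + 24) * delta.
  have := bern_concentration hp a_bnd r d0; rewrite -/V -/W.
  have := bern_mean_norm_sum hp a; rewrite -/V -/W.
  rewrite /K bern_meanD !bern_meanZ bern_meanD bern_mean_cst bern_meanZ bern_meanD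
    bern_mean_cst.
  set m1 := bern_mean p (fun b => `|W b|).
  set m2 := bern_mean p (fun b => (`|W b - r| <= delta)%R%:R).
  move=> hm1 hm2.
  have e1 : delta * (1 + V) <= 3 * delta by nra.
  have e2 : stein_const R + 2 * (m1 + 1) <= stein_const R + 5 by lra.
  have e3 : V * (delta * (stein_const R + 2 * (m1 + 1))) <=
      2 * (delta * (stein_const R + 5)).
    apply: ler_pM => //.
      rewrite mulr_ge0// addr_ge0// mulr_ge0// addr_ge0//.
      by rewrite -(@bern_mean_cst R p I 0); apply: (ler_bern_mean hp) => b.
    by rewrite ler_wpM2l.
  by rewrite mulrDr; nra.
apply: (le_trans (lerD (ler_wpM2l (normr_ge0 _) Hg) (le_trans H HK))).
by have := normr_ge0 (1 - V); nra.
Qed.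

End berry_esseen.

(** * From the probability space to finite expectations *)

Section transfer.
Context d (T : measurableType d) (R : realType) (P : probability T R) (p : R).
Context (eps : nat -> {RV P >-> bool}) (n : nat -> nat).
Hypotheses (hp : 0 < p < 1) (heps : iid_bernoulli P p eps) (n_inj : injective n).
Variable k : nat.
Implicit Types (b : {ffun 'I_k -> bool}) (g : {ffun 'I_k -> bool} -> R).

Definition outcomes (t : T) : {ffun 'I_k -> bool} := [ffun j : 'I_k => eps (n j) t].

(** Independence speaks of finite sets of indices of [eps], so the event is written over the image
    of [n]. Quantifying over all [j] with [n j = i] avoids an inverse of [n]. *)
Lemma outcomes_preimage b :
  outcomes @^-1` [set b] =
  \bigcap_(i in [set` [fset n (nat_of_ord j) | j in 'I_k]%fset])
    (eps i @^-1` [set v | forall j : 'I_k, n j = i -> v = b j]).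
Proof.
apply/seteqP; split => [t /= <- i _ j <-|t /= H]; first by rewrite ffunE.
apply/ffunP => j; rewrite ffunE; apply: (H (n j)) => //=.
by apply/imfsetP; exists j.
Qed.

Lemma measurable_outcomes b : measurable (outcomes @^-1` [set b]).
Proof.
rewrite outcomes_preimage; apply: fin_bigcap_measurable => // i _.
by rewrite -[X in measurable X]setTI; exact: (measurable_funPT (eps i)).
Qed.

Lemma outcomes_prob b :
  P (outcomes @^-1` [set b]) = (bern_weight p b)%:E.
Proof.
rewrite outcomes_preimage heps.1//.
(* Injectivity of [n] gives one factor per coordinate, and below reduces each event to a single
   value of [eps (n j)]. *)
rewrite big_imfset /=; last by move=> i j _ _ /n_inj/ord_inj.
rewrite /bern_weight -prodEFin big_enum_cond /=; apply: eq_bigr => j _.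
have -> : [set v | forall i : 'I_k, n i = n j -> v = b i] = [set b j].
  by apply/seteqP; split => [v /= H|v /= -> i /n_inj/ord_inj ->//]; exact: H.
rewrite -[LHS]/(distribution P (eps (n j)) [set b j]) (heps.2 (n j))//.
rewrite bernoulli_probE; last by case/andP: hp => p0 p1; rewrite !ltW.
rewrite !diracE; case: (b j).
  by rewrite mem_set//= memNset//= mule1 mule0 adde0.
by rewrite memNset//= mem_set//= mule1 mule0 add0e.
Qed.

Lemma expectation_outcomes g :
  ('E_P[fun t => g (outcomes t)] = (bern_mean p g)%:E)%E.
Proof.
(* The variable is a simple function: it takes finitely many values, on the events of
   [measurable_outcomes]. *)
have -> : (fun t => g (outcomes t)) =
    (\sum_b (fun t => g b * \1_(outcomes @^-1` [set b]) t)).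
  apply/funext => t; rewrite fct_sumE (bigD1 (outcomes t))//= indicE mem_set//.
  rewrite mulr1 big1 ?addr0// => b bt; rewrite indicE memNset ?mulr0//=.
  by move/esym/eqP; rewrite (negbTE bt).
rewrite unlock.
under eq_integral do rewrite fct_sumE -sumEFin.
rewrite integral_sum//=; last first.
  move=> b; rewrite (_ : (fun _ => _) =
    (fun t => (g b)%:E * (\1_(outcomes @^-1` [set b]) t)%:E)%E); last first.
    by apply/funext => t; rewrite EFinM.
  apply: integrableZl => //.
  by apply: integrable_indic => //; exact: measurable_outcomes.
rewrite /bern_mean -sumEFin; apply: eq_bigr => b _.
under eq_integral do rewrite EFinM.
rewrite integralZl//; last first.
  by apply: integrable_indic => //; exact: measurable_outcomes.
rewrite integral_indic ?setIT//; last exact: measurable_outcomes.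
rewrite mulrC EFinM; congr (_ * _)%E; exact: outcomes_prob.
Qed.

Lemma cdf_outcomes (X : {RV P >-> R}) g r : X =1 g \o outcomes ->
  cdf X r = (bern_mean p (fun b => (g b <= r)%R%:R))%:E.
Proof.
move=> Xg; rewrite -expectation_outcomes.
rewrite -[LHS]/(P (X @^-1` `]-oo, r])) -expectation_indic//; last first.
  by rewrite -[X in measurable X]setTI; exact: measurable_funPT.
congr (expectation P _); apply/funext => t; rewrite indicE; congr ((nat_of_bool _)%:R).
rewrite -[in RHS](Xg t : _ = g (outcomes t)).
by apply/idP/idP => [/set_mem|H]; [|apply/mem_set]; rewrite /= in_itv.
Qed.

Lemma variance_outcomes g :
  ('V_P[fun t => g (outcomes t)] =
  (bern_mean p (fun b => (g b - bern_mean p g) ^+ 2)%R)%:E)%E.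
Proof.
rewrite -expectation_outcomes /variance unlock; congr (expectation P _).
by apply/funext => t; rewrite expectation_outcomes /= expr2.
Qed.

End transfer.

(** * Mixtures of two translated normal laws *)

Section gaussian_mixture.
Context (R : realType) (p : R) (hp : 0 < p < 1).
Local Notation F := (@normal_cdf R 0 1).
Local Notation phi := (@normal_pdf R 0 1).
Let p_gt0 : 0 < p. Proof. by case/andP: hp. Qed.
Let p_lt1 : p < 1. Proof. by case/andP: hp. Qed.
Let one0 : (1 : R) != 0. Proof. exact: oner_neq0. Qed.

(* The distribution function of [Z + a * (B - p)], with [Z] standard normal and
   [B] an independent Bernoulli variable. *)
Definition mixture_cdf (a r : R) : R :=
  p * F (r - a * (1 - p)) + (1 - p) * F (r + a * p).

(* A Gaussian sequence [E] has a constant ratio [E t.+2 * E t / E t.+1 ^+ 2],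
   whereas for a sum [l] of two exponentials [l t.+2 * l t - l t.+1 ^+ 2] is a
   nonzero geometric sequence of ratio [x * y]. *)
Lemma two_exponentials_not_gaussian (A B D x y u w : R) :
  0 < A -> 0 < B -> 0 < x -> 0 < y -> x != y ->
  ~ (forall t : nat, A * x ^+ t + B * y ^+ t = D * u ^+ t * w ^+ (t ^ 2)).
Proof.
move=> A0 B0 x0 y0 xy H.
pose l t := A * x ^+ t + B * y ^+ t.
have l_gt0 t : 0 < l t by rewrite addr_gt0// mulr_gt0// exprn_gt0.
pose De := A * B * (x - y) ^+ 2.
have De_gt0 : 0 < De.
  apply: mulr_gt0; first exact: mulr_gt0.
  by rewrite lt0r sqr_ge0 andbT sqrf_eq0 subr_eq0.
have hl t : l t.+2 * l t - l t.+1 ^+ 2 = De * (x * y) ^+ t.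
  by rewrite /l /De !exprSr exprMn; ring.
have hE t : l t.+2 * l t = w ^+ 2 * l t.+1 ^+ 2.
  rewrite /l !H.
  have -> : (t.+2 ^ 2 = t * t + 4 * t + 4)%N by rewrite -mulnn; lia.
  have -> : (t.+1 ^ 2 = t * t + 2 * t + 1)%N by rewrite -mulnn; lia.
  have -> : (t ^ 2 = t * t)%N by rewrite mulnn.
  have -> : w ^+ (t * t + 4 * t + 4) = w ^+ (t * t) * (w ^+ t) ^+ 4 * w ^+ 4.
    by rewrite (exprD w (_ + _)) (exprD w (t * t)) (mulnC 4%N) (exprM w t 4).
  have -> : w ^+ (t * t + 2 * t + 1) = w ^+ (t * t) * (w ^+ t) ^+ 2 * w.
    by rewrite (exprD w (_ + _)) (exprD w (t * t)) (mulnC 2%N) (exprM w t 2).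
  by rewrite !exprSr; ring.
(* Comparing the two expressions makes the squares of [l] geometric. Then $l_2^2 = l_3 l_1$, against
   the positive gap given by [hl] at 1. *)
have k t : (w ^+ 2 - 1) * l t.+1 ^+ 2 = De * (x * y) ^+ t.
  by rewrite -hl hE; ring.
have w1 : w ^+ 2 - 1 != 0.
  apply: contraTneq De_gt0 => w0; have := k 0%N.
  by rewrite w0 mul0r expr0 mulr1 => <-; rewrite ltxx.
have e : (l 2%N ^+ 2) ^+ 2 = (l 3%N * l 1%N) ^+ 2.
  apply: (mulfI (expf_neq0 2 w1)); rewrite -exprMn k exprMn [RHS]mulrA.
  rewrite [LHS](_ : _ = (De * (x * y) ^+ 2) * (De * (x * y) ^+ 0)); last by ring.
  by rewrite -!k; ring.
have : l 2%N ^+ 2 = l 3%N * l 1%N.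
  by apply: (@pexpIrn _ 2) => //; rewrite nnegrE ?sqr_ge0// mulr_ge0// ltW.
have := hl 1%N; move=> h2 h3; have : 0 < De * (x * y) ^+ 1.
  by rewrite mulr_gt0// expr1 mulr_gt0.
by rewrite -h2 h3 subrr ltxx.
Qed.

Lemma is_derive_mixture_cdf a (r : R) :
  is_derive r 1 (mixture_cdf a)
    (p * phi (r - a * (1 - p)) + (1 - p) * phi (r + a * p)).
Proof.
have sh (c : R) : is_derive r 1 (fun z => F (z + c)) (phi (r + c)).
  have d1 : is_derive r 1 (shift c : R -> R) 1 by exact: is_derive_shift.
  have d2 := is_derive_normal_cdf 0 (shift c r : R) one0.
  by apply: (is_derive_eq (is_derive1_comp d2 d1)); rewrite mulr1.
exact: (is_derive_eq (is_deriveD (is_deriveZ p (sh (- (a * (1 - p)))))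
  (is_deriveZ (1 - p) (sh (a * p))))).
Qed.

(** Equality passes to the densities. Multiplied by $e^{t^2/2}$ and restricted to natural [t], the
    mixture becomes a sum of two exponentials, with distinct bases since [a > 0], while the normal
    density keeps the form $D u^t w^{t^2}$. *)
Lemma mixture_cdf_neq_normal (a m s : R) : 0 < a -> 0 < s ->
  ~ (mixture_cdf a =1 normal_cdf m s).
Proof.
move=> a0 s0 H; have sn0 : s != 0 by rewrite gt_eqF.
have E r : p * phi (r - a * (1 - p)) + (1 - p) * phi (r + a * p) =
    normal_pdf m s r.
  rewrite -(@derive_val _ _ _ _ _ _ _ (is_derive_mixture_cdf a r)).
  by rewrite (funext H) (@derive_val _ _ _ _ _ _ _ (is_derive_normal_cdf m r sn0)).
pose x : R := expR (a * (1 - p)); pose y : R := expR (- (a * p)).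
pose A := p * expR (- (a * (1 - p)) ^+ 2 / 2).
pose B := (1 - p) * expR (- (a * p) ^+ 2 / 2).
pose D := normal_peak s / normal_peak 1 * expR (- m ^+ 2 / (s ^+ 2 *+ 2)).
have pk : normal_peak (1 : R) != 0 by rewrite gt_eqF// normal_peak_gt0.
have tilt (c : R) (t : nat) : normal_peak 1 *
    expR (- (t%:R + c - 0) ^+ 2 / (1 ^+ 2 *+ 2)) / normal_peak 1 *
    expR (t%:R ^+ 2 / 2) = expR (- c ^+ 2 / 2) * expR (- c) ^+ t.
  rewrite [normal_peak 1 * _]mulrC mulfK// -expRM_natr -!expRD; congr expR.
  by field.
apply: (@two_exponentials_not_gaussian A B D x y (expR (m / s ^+ 2))
  (expR (1 / 2 - 1 / (s ^+ 2 *+ 2)))).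
- by rewrite mulr_gt0 ?expR_gt0.
- by rewrite mulr_gt0 ?expR_gt0// subr_gt0.
- exact: expR_gt0.
- exact: expR_gt0.
- rewrite gt_eqF// ltr_expR (@lt_trans _ _ 0)// ?oppr_lt0 mulr_gt0// subr_gt0//.
move=> t; have := E t%:R; rewrite !normal_pdfE// /normal_fun.
move=> /(congr1 (fun z => z / normal_peak 1 * expR (t%:R ^+ 2 / 2))) Et.
transitivity (normal_peak s * expR (- (t%:R - m) ^+ 2 / (s ^+ 2 *+ 2)) /
   normal_peak 1 * expR (t%:R ^+ 2 / 2)).
  symmetry; rewrite -Et (mulrDl _ _ (normal_peak 1)^-1) (mulrDl _ _ (expR _)).
  congr (_ + _).
    rewrite [LHS](_ : _ = p * (normal_peak 1 * expR (- (t%:R - a * (1 - p) - 0) ^+ 2 /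
      (1 ^+ 2 *+ 2)) / normal_peak 1 * expR (t%:R ^+ 2 / 2))); last by ring.
    by rewrite tilt opprK sqrrN mulrA.
  rewrite [LHS](_ : _ = (1 - p) * (normal_peak 1 * expR (- (t%:R + a * p - 0) ^+ 2 /
    (1 ^+ 2 *+ 2)) / normal_peak 1 * expR (t%:R ^+ 2 / 2))); last by ring.
  by rewrite tilt mulrA.
rewrite /D -!expRM_natr natrX.
rewrite [LHS](_ : _ = normal_peak s / normal_peak 1 *
  (expR (- (t%:R - m) ^+ 2 / (s ^+ 2 *+ 2)) * expR (t%:R ^+ 2 / 2))); last by ring.
rewrite -!mulrA -!expRD; congr (_ * (_ * expR _)).
by move: (t%:R) => z; field.
Qed.

Lemma mixture_cdf_continuous r : continuous (mixture_cdf ^~ r).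
Proof.
have sh (c d : R) : continuous (fun a : R => F (c + a * d)).
  move=> a; apply: (@continuous_comp _ _ _ (fun a : R => c + a * d) F).
    by apply: cvgD; [exact: cvg_cst|apply: cvgM; [exact: cvg_id|exact: cvg_cst]].
  apply: (@continuous_is_derive _ _ phi) => z.
  exact: is_derive_normal_cdf.
have -> : mixture_cdf ^~ r =
    (fun a => p * F (r + a * - (1 - p)) + (1 - p) * F (r + a * p)).
  by apply/funext => a; rewrite mulrN.
move=> a; have c1 := sh r (- (1 - p)) a; have c2 := sh r p a.
by apply: cvgD; apply: cvgM; [exact: cvg_cst|exact: c1|exact: cvg_cst|exact: c2].
Qed.

Lemma mixture_not_normal (alpha : nat -> R) (m s : R) :
  (forall k, 0 <= alpha k) -> 0 < s ->
  (forall r, mixture_cdf (alpha k) r @[k --> \oo] --> normal_cdf m s r) ->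
  alpha k @[k --> \oo] --> (0 : R).
Proof.
move=> al0 s0 H; have sn0 : s != 0 by rewrite gt_eqF.
pose G := normal_cdf m s.
(* The limit gives the interval from 0 to 1 positive mass [e]. If [alpha k] exceeds the bound chosen
   below, one component sees this interval left-shifted below [v1] and the other right-shifted
   beyond [v2], so the mixture gives it at most [e / 2]. *)
have [A bndA] : exists A, \forall k \near \oo, alpha k <= A.
  pose e := G 1 - G 0; have e0 : 0 < e by rewrite subr_gt0 normal_cdf_lt.
  have e2 : 0 < e / 2 by lra.
  have [v1 hv1] := normal_cdf_small 0 1 e2.
  have [v2 hv2] := normal_cdf_large 0 1 e2.
  have Hd : mixture_cdf (alpha k) 1 - mixture_cdf (alpha k) 0 @[k --> \oo] --> e.
    by apply: cvgB; exact: H.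
  exists (Num.max ((1 - v1) / (1 - p)) (v2 / p)).
  have : \forall k \near \oo,
      e / 2 < mixture_cdf (alpha k) 1 - mixture_cdf (alpha k) 0.
    by apply: (cvgr_gt _ Hd); lra.
  apply: filterS => k; apply: contraTT; rewrite -ltNge gt_max => /andP[].
  rewrite ltr_pdivrMr ?subr_gt0// ltr_pdivrMr// => h1 h2; rewrite -leNgt.
  have F_le u v : u <= v -> F u <= F v.
    by rewrite le_eqVlt => /predU1P[->//|uv]; rewrite ltW// normal_cdf_lt.
  have f1 : F (1 - alpha k * (1 - p)) <= F v1 by apply: F_le; lra.
  have f2 : F v2 <= F (0 + alpha k * p) by apply: F_le; lra.
  have f3 := normal_cdf_le1 0 1 (1 + alpha k * p).
  have f4 := normal_cdf_ge0 0 1 (0 - alpha k * (1 - p)).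
  rewrite /mixture_cdf.
  have g1 : F (1 - alpha k * (1 - p)) - F (0 - alpha k * (1 - p)) <= e / 2 by lra.
  have g2 : F (1 + alpha k * p) - F (0 + alpha k * p) <= e / 2 by lra.
  rewrite (_ : _ - _ =
    p * (F (1 - alpha k * (1 - p)) - F (0 - alpha k * (1 - p))) +
    (1 - p) * (F (1 + alpha k * p) - F (0 + alpha k * p))); last by ring.
  rewrite [leRHS](_ : _ = p * (e / 2) + (1 - p) * (e / 2)); last by ring.
  by apply: lerD; apply: ler_wpM2l => //; rewrite ?subr_ge0 ltW.
apply/cvgrPdist_lt => eta eta0.
apply: contrapT => far.
(* If [alpha] does not tend to 0, it lies in this segment infinitely often; compactness yields a
   cluster point [a >= eta], at which the mixture equals the normal limit. *)
pose D := [set k | eta <= alpha k <= A].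
pose Fi := alpha @ within D \oo.
have FiP : ProperFilter Fi.
  apply: fmap_proper_filter; apply: Build_ProperFilter.
  case=> N _ HN; apply: far.
  near=> k.
  rewrite sub0r normrN ger0_norm// ltNge; apply/negP => eak.
  apply: (HN k); rewrite /D /=; first by near: k; exists N.
  by rewrite eak /=; near: k.
have [|a [/=]] := @segment_compact R eta A Fi FiP.
  by apply: nearW => k; rewrite /D /= in_itv.
rewrite in_itv /= => /andP[ea aA] cla.
apply: (@mixture_cdf_neq_normal a m s) => //; first exact: lt_le_trans ea.
move=> r; apply/eqP; rewrite -subr_eq0 -normr_le0; apply/ler_addgt0Pr => e e0.
have e2 : 0 < e / 2 by lra.
have [||b []] := cla [set x | `|mixture_cdf x r - G r| < e / 2]
  [set x | `|mixture_cdf x r - mixture_cdf a r| < e / 2].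
- rewrite /Fi /=; move/cvgrPdistC_lt : (H r) => /(_ _ e2).
  by apply: filterS.
- by move/cvgrPdistC_lt : (@mixture_cdf_continuous r a) => /(_ _ e2).
rewrite /= add0r => h1 h2.
rewrite (_ : _ - _ = (mixture_cdf b r - G r) -
  (mixture_cdf b r - mixture_cdf a r)); last by rewrite /G; ring.
by rewrite (le_trans (ler_normB _ _))// (le_trans (lerD (ltW h1) (ltW h2)))//; lra.
Unshelve. all: by end_near.
Qed.

End gaussian_mixture.

(** * Limits of Bernoulli sums *)

Section limits.
Context (R : realType) (p : R) (hp : 0 < p < 1).
Let p_gt0 : 0 < p. Proof. by case/andP: hp. Qed.
Let p_lt1 : p < 1. Proof. by case/andP: hp. Qed.

Lemma cvg_dist_bound (f g h : nat -> R) (l : R) :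
  (\forall k \near \oo, `|f k - g k| <= h k) -> h k @[k --> \oo] --> (0 : R) ->
  f k @[k --> \oo] --> l -> g k @[k --> \oo] --> l.
Proof.
move=> fgh h0 fl; rewrite (_ : g = fun k => f k - (f k - g k)); last first.
  by apply/funext => k; ring.
rewrite -[l]subr0; apply: cvgB => //.
apply/cvgr0Pnorm_le => e e0; move/cvgr0Pnorm_le : h0 => /(_ _ e0) he.
near=> k; apply: (@le_trans _ _ (h k)); first by near: k.
by rewrite (le_trans (ler_norm _))//; near: k.
Unshelve. all: by end_near.
Qed.

Lemma bern_sum_var_div (I : finType) (a : I -> R) (s : R) :
  bern_sum_var p (fun i => a i / s) = bern_sum_var p a / s ^+ 2.
Proof.
rewrite /bern_sum_var -[RHS]mulrA mulr_suml; congr (_ * _); apply: eq_bigr => i _.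
by rewrite expr_div_n.
Qed.

Lemma bern_clt (a : forall k, 'I_k -> R) (delta : nat -> R) (r : R) :
  (\forall k \near \oo, forall j, 0 <= a k j <= delta k) ->
  delta k @[k --> \oo] --> (0 : R) ->
  bern_sum_var p (a k) @[k --> \oo] --> (1 : R) ->
  bern_mean p (fun b => (bern_sum p (a k) b <= r)%R%:R) @[k --> \oo]
    --> normal_cdf 0 1 r.
Proof.
move=> ab d0 v1; have [C C0 BE] := bernoulli_berry_esseen hp.
apply: (@cvg_dist_bound (fun=> normal_cdf 0 1 r) _
  (* The absolute value is taken because [delta k] is not assumed nonnegative. *)
  (fun k => C * (`|delta k| + `|1 - bern_sum_var p (a k)|))).
- near=> k; rewrite distrC; apply: BE.
  + by rewrite normr_ge0 /=; near: k; exact: cvgr0_norm_le.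
  + move=> j; have /(_ j)/andP[-> /=] : forall j, 0 <= a k j <= delta k.
      by near: k.
    by move=> /le_trans; apply; exact: ler_norm.
  + by near: k; apply: (cvgr_le _ v1); lra.
- rewrite -[0](mulr0 C); apply: cvgM; first exact: cvg_cst.
  rewrite -[0](addr0 0); apply: cvgD; first by apply/norm_cvg0P.
  apply/norm_cvg0P; rewrite -(subrr 1); apply: cvgB => //; exact: cvg_cst.
- exact: cvg_cst.
Unshelve. all: by end_near.
Qed.

(** Setting the weight at [i] to 0, instead of deleting the index, keeps the space of outcomes
    unchanged. *)
Lemma bern_sum_upd_split (I : finType) (a : I -> R) (i : I) b v :
  bern_sum p a (upd b i v) =
  bern_sum p (fun j => if j != i then a j else 0) b + a i * (v%:R - p).
Proof.
rewrite /bern_sum (bigD1 i)//= [in RHS](bigD1 i)//= eqxx mul0r add0r upd_at.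
rewrite addrC; congr (_ + _); apply: eq_bigr => j ji.
by rewrite ji ffunE (negbTE ji).
Qed.

Lemma bern_sum_var_split (I : finType) (a : I -> R) (i : I) :
  bern_sum_var p a =
  bern_sum_var p (fun j => if j != i then a j else 0) + p * (1 - p) * a i ^+ 2.
Proof.
rewrite /bern_sum_var (bigD1 i)//= [in RHS](bigD1 i)//= eqxx expr0n /= add0r.
rewrite mulrDr addrC; congr (_ * _ + _); apply: eq_bigr => j ji.
by rewrite ji.
Qed.

Lemma bern_mean_cdf_split (I : finType) (a : I -> R) (i : I) (r : R) :
  bern_mean p (fun b => (bern_sum p a b <= r)%R%:R) =
  p * bern_mean p (fun b =>
    (bern_sum p (fun j => if j != i then a j else 0) b <=
     r - a i * (1 - p))%R%:R) +
  (1 - p) * bern_mean p (fun b =>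
    (bern_sum p (fun j => if j != i then a j else 0) b <= r + a i * p)%R%:R).
Proof.
rewrite (bern_mean_resample _ _ i); congr (_ * _ + _ * _).
  by apply: eq_bern_mean => b; rewrite bern_sum_upd_split lerBrDr.
apply: eq_bern_mean => b.
by rewrite bern_sum_upd_split sub0r mulrN lerBlDr.
Qed.

(** Conditioning on coordinate [i k] leaves two normal approximations at shifted points. The shift
    to [k.+1] guarantees that a distinguished index exists. *)
Lemma bern_mixture_limit (a : forall k, 'I_k -> R) (i : forall k, 'I_k.+1)
    (delta : nat -> R) (r l : R) :
  (\forall k \near \oo, forall j, j != i k -> 0 <= a k.+1 j <= delta k.+1) ->
  delta k @[k --> \oo] --> (0 : R) ->
  (\forall k \near \oo,
    bern_sum_var p (fun j => if j != i k then a k.+1 j else 0) = 1) ->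
  bern_mean p (fun b => (bern_sum p (a k) b <= r)%R%:R) @[k --> \oo] --> l ->
  mixture_cdf p (a k.+1 (i k)) r @[k --> \oo] --> l.
Proof.
move=> ab d0 v1 hl; have [C C0 BE] := bernoulli_berry_esseen hp.
have d0' : delta k.+1 @[k --> \oo] --> (0 : R) by rewrite (cvg_shiftS delta).
apply: (@cvg_dist_bound
  (fun k => bern_mean p (fun b => (bern_sum p (a k.+1) b <= r)%R%:R)) _
  (fun k => C * `|delta k.+1|)); last 1 first.
- by rewrite (cvg_shiftS (fun k =>
    bern_mean p (fun b => (bern_sum p (a k) b <= r)%R%:R))).
- near=> k; rewrite (bern_mean_cdf_split _ (i k)) /mixture_cdf.
  have va' : bern_sum_var p (fun j => if j != i k then a k.+1 j else 0) = 1.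
    by near: k.
  have abk : forall j, j != i k -> 0 <= a k.+1 j <= delta k.+1 by near: k.
  have dk : 0 <= `|delta k.+1| <= 1.
    by rewrite normr_ge0 /=; near: k; exact: cvgr0_norm_le.
  set a' := (fun j => _) in va' *.
  have ba' j : 0 <= a' j <= `|delta k.+1|.
    rewrite /a'; case: ifPn => ji; last by rewrite lexx normr_ge0.
    have /andP[-> /=] := abk j ji.
    by move=> /le_trans; apply; exact: ler_norm.
  have H z := BE _ a' _ z dk ba'.
  rewrite va' subrr normr0 addr0 in H.
  have v2 : (1 : R) <= 2 by lra.
  have H1 := H (r - a k.+1 (i k) * (1 - p)) v2.
  have H2 := H (r + a k.+1 (i k) * p) v2.
  set f1 := bern_mean _ _ in H1 *; set f2 := bern_mean _ _ in H2 *.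
  set F1 := normal_cdf _ _ _ in H1 *; set F2 := normal_cdf _ _ _ in H2 *.
  rewrite (_ : _ - _ = p * (f1 - F1) + (1 - p) * (f2 - F2)); last by ring.
  rewrite (le_trans (ler_normD _ _))// !normrM (gtr0_norm p_gt0).
  rewrite (gtr0_norm (x := 1 - p)) ?subr_gt0//.
  rewrite [leRHS](_ : _ = p * (C * `|delta k.+1|) +
    (1 - p) * (C * `|delta k.+1|)); last by ring.
  by apply: lerD; apply: ler_wpM2l => //; rewrite ?subr_ge0 ltW.
- rewrite -[0](mulr0 C); apply: cvgM; first exact: cvg_cst.
  by apply/norm_cvg0P.
Unshelve. all: by end_near.
Qed.

Definition two_point_cdf (l0 l1 r : R) : R :=
  p * (l1 <= r)%R%:R + (1 - p) * (l0 <= r)%R%:R.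

(** The sum minus [c * (b i - p)] is again a Bernoulli sum. As [r] is at distance at least [e] from
    both atoms, the two indicators can differ only where this difference reaches [e], and
    Chebyshev's inequality applies. *)
Lemma bern_two_point (I : finType) (a : I -> R) (i : I) (c r e : R) :
  0 < e -> e <= `|r - c * (1 - p)| -> e <= `|r + c * p| ->
  `|bern_mean p (fun b => (bern_sum p a b <= r)%R%:R) -
    two_point_cdf (- (c * p)) (c * (1 - p)) r| <=
  bern_sum_var p (fun j => a j - (if j == i then c else 0)) / e ^+ 2.
Proof.
move=> e0 e1 e2; set a' := (fun j => a j - _).
have -> : two_point_cdf (- (c * p)) (c * (1 - p)) r =
    bern_mean p (fun b : {ffun I -> bool} => (c * ((b i)%:R - p) <= r)%R%:R).
  rewrite (bern_mean_resample _ _ i) /two_point_cdf; congr (_ * _ + _ * _).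
    by under eq_bern_mean do rewrite upd_at; rewrite bern_mean_cst.
  under eq_bern_mean do rewrite upd_at sub0r mulrN.
  by rewrite bern_mean_cst.
rewrite -bern_meanB (le_trans (ler_norm_bern_mean hp _))//.
rewrite (le_trans _ (bern_chebyshev hp a' e0))//.
apply: (ler_bern_mean hp) => b /=.
have dE : bern_sum p a' b = bern_sum p a b - c * ((b i)%:R - p).
  rewrite /bern_sum /a'.
  under eq_bigr do rewrite mulrBl.
  rewrite sumrB; congr (_ - _); rewrite (bigD1 i)//= eqxx big1 ?addr0//.
  by move=> j /negbTE ->; rewrite mul0r.
rewrite dE; set X := bern_sum p a b; set Y := c * _.
have eY : e <= `|r - Y|.
  rewrite /Y; case: (b i) => //=.
  by rewrite sub0r mulrN opprK.
have [h|h] := lerP e `|X - Y|.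
  by case: (X <= r); case: (Y <= r); rewrite ?subrr ?subr0 ?sub0r ?normrN ?normr0 ?normr1.
suff -> : (X <= r) = (Y <= r) by rewrite subrr normr0.
move: eY h; rewrite ltr_norml ler_normr => /orP[] ? /andP[? ?].
  by apply/idP/idP => _; lra.
by apply/idP/idP => ?; exfalso; lra.
Qed.

End limits.

(** The normal distribution function is continuous, so every point is tested. *)
Lemma normal_cvgP d (T : measurableType d) (R : realType) (P : probability T R)
    (X : nat -> {RV P >-> R}) (h : nat -> R -> R) (m s : R) : s != 0 ->
  (forall k r, cdf (X k) r = (h k r)%:E) ->
  cvg_in_distribution P X (normal_prob m s) <->
  forall r, h k r @[k --> \oo] --> normal_cdf m s r.
Proof.
move=> s0 Xh.
have Nc : (fun u : R => normal_prob m s `]-oo, u]) = EFin \o normal_cdf m s.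
  by apply/funext => u; rewrite normal_cdfE.
have cN (r : R) : {for r, continuous (fun u : R => normal_prob m s `]-oo, u])}.
  rewrite Nc; apply: cvg_EFin; first exact: nearW.
  apply: (@continuous_is_derive _ _ (normal_pdf m s)) => z.
  exact: is_derive_normal_cdf.
split=> [H r|H r _].
  have := H r (cN r); rewrite normal_cdfE => /fine_cvg.
  by under eq_fun do rewrite Xh.
rewrite normal_cdfE; under eq_fun do rewrite Xh.
by apply: cvg_EFin; [exact: nearW|exact: H].
Qed.

(** * The two regimes *)

Section weighted_sums.
Context d (T : measurableType d) (R : realType) (P : probability T R) (p : R).
Context (eps : nat -> {RV P >-> bool}) (n : nat -> nat).
Hypotheses (hp : 0 < p < 1) (heps : iid_bernoulli P p eps) (n_inj : injective n).
Variables (k : nat) (a : 'I_k -> R).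

Definition weighted_sum (t : T) : R := \sum_(j < k) (eps (n j) t)%:R * a j.

Let g (b : {ffun 'I_k -> bool}) : R := bern_sum p a b + p * \sum_j a j.

Let weighted_sumE t : weighted_sum t = g (outcomes eps n k t).
Proof.
rewrite /g /weighted_sum /bern_sum mulr_sumr -big_split; apply: eq_bigr => j _ /=.
by rewrite ffunE; ring.
Qed.

Lemma expectation_weighted_sum :
  ('E_P[weighted_sum] = (p * \sum_j a j)%:E)%E.
Proof.
rewrite (funext weighted_sumE) (expectation_outcomes hp heps n_inj g).
by rewrite bern_meanD bern_mean_sum0 bern_mean_cst add0r.
Qed.

Lemma variance_weighted_sum :
  ('V_P[weighted_sum] = (bern_sum_var p a)%:E)%E.
Proof.
rewrite (funext weighted_sumE) (variance_outcomes hp heps n_inj g).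
rewrite bern_meanD bern_mean_sum0 bern_mean_cst add0r.
by under eq_bern_mean do rewrite addrK; rewrite bern_mean_sum_sqr.
Qed.

Lemma cdf_weighted_sum (X : {RV P >-> R}) (s r : R) : X =1 weighted_sum ->
  cdf (standardize X (fine 'E_P[X]) s : {RV P >-> R}) r =
  (bern_mean p (fun b => (bern_sum p (fun j => a j / s) b <= r)%R%:R))%:E.
Proof.
move=> XE; apply: (cdf_outcomes hp heps n_inj) => t /=.
rewrite /standardize (funext XE) expectation_weighted_sum /= weighted_sumE /g.
by rewrite addrK /bern_sum mulr_suml; apply: eq_bigr => j _; rewrite mulrAC.
Qed.

End weighted_sums.

Section bernoulli_regimes.
Context (R : realType) (p : R) (hp : 0 < p < 1).
Context d (T : measurableType d) (P : probability T R).
Context (eps : nat -> {RV P >-> bool}) (heps : iid_bernoulli P p eps).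
Context (n : nat -> nat) (n_inj : injective n) (y : nat -> nat).
Let p_gt0 : 0 < p. Proof. by case/andP: hp. Qed.
Let p_lt1 : p < 1. Proof. by case/andP: hp. Qed.
Let q := p * (1 - p).
Let q_gt0 : 0 < q. Proof. by rewrite mulr_gt0// subr_gt0. Qed.
Local Notation S := (partial_sum eps n y).

Let w k : 'I_k -> R := fun j => (y j)%:R.

Lemma partial_sum_weighted k : S k = weighted_sum eps n (w (k := k)).
Proof. by []. Qed.

Lemma partial_sum_moments k :
  ('E_P[S k] = (p * (\sum_(j < k) y j)%N%:R)%:E /\
   'V_P[S k] = (p * (1 - p) * (\sum_(j < k) y j ^ 2)%N%:R)%:E)%E.
Proof.
rewrite partial_sum_weighted (expectation_weighted_sum hp heps n_inj).
rewrite (variance_weighted_sum hp heps n_inj) /bern_sum_var !natr_sum; split=> //.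
by under [in RHS]eq_bigr do rewrite natrX.
Qed.

Lemma cdf_partial_sum k (s r : R) :
  cdf (standardize (S k) (mean_sum eps n y P k) s : {RV P >-> R}) r =
  (bern_mean p (fun b => (bern_sum p (fun j : 'I_k => (y j)%:R / s) b <= r)%R%:R))%:E.
Proof. exact: (cdf_weighted_sum hp heps n_inj (a := w (k := k))). Qed.

Lemma variance_summand k i : (i < k)%N ->
  ('V_P[summand eps n y i] = (p * (1 - p) * (y i ^ 2)%N%:R)%:E)%E.
Proof.
move=> ik; pose a (j : 'I_k) : R := if j == Ordinal ik then (y i)%:R else 0.
have -> : summand eps n y i = weighted_sum eps n a.
  apply/funext => t; rewrite /weighted_sum (bigD1 (Ordinal ik))//= /a eqxx.
  by rewrite big1 ?addr0// => j /negbTE ->; rewrite mulr0.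
rewrite (variance_weighted_sum hp heps n_inj) /bern_sum_var.
rewrite (bigD1 (Ordinal ik))//= {1}/a eqxx big1 ?addr0 ?natrX//.
by move=> j /negbTE ji; rewrite /a ji expr0n.
Qed.

(** * Trimmed sums and reinsertion of the removed term *)

Section trimmed.
Variable jk : nat -> nat.
Let v k : 'I_k -> R := fun j => if j != jk k :> nat then (y j)%:R else 0.

Lemma cdf_trimmed_sum k (s r : R) :
  cdf (standardize (trimmed_sum eps n y jk k)
         (fine 'E_P[trimmed_sum eps n y jk k]) s : {RV P >-> R}) r =
  (bern_mean p (fun b => (bern_sum p (fun j : 'I_k => v j / s) b <= r)%R%:R))%:E.
Proof.
apply: (cdf_weighted_sum hp heps n_inj) => t.
rewrite /weighted_sum /= /trimmed_sum big_mkcond; apply: eq_bigr => j _.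
by rewrite /v /summand; case: ifP => // _; rewrite mulr0.
Qed.

Lemma trimmed_weights_var k : bern_sum_var p (v (k := k)) = trimmed_var p y jk k.
Proof.
rewrite /bern_sum_var /trimmed_var /residual natr_sum [in RHS]big_mkcond /=.
congr (_ * _); apply: eq_bigr => j _; rewrite /v.
by case: ifP => _; rewrite ?natrX// expr0n.
Qed.

Lemma total_var_split k : (jk k < k)%N ->
  bern_sum_var p (w (k := k)) = trimmed_var p y jk k + q * (y (jk k))%:R ^+ 2.
Proof.
move=> jkk; rewrite (bern_sum_var_split _ _ (Ordinal jkk)) /= -trimmed_weights_var.
by congr (_ + _); rewrite /bern_sum_var; congr (_ * _).
Qed.

Hypothesis jkP : index_choice jk.
Hypothesis var_y : trimmed_var p y jk k @[k --> \oo] --> +oo.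
Hypothesis max0 : ((residual_max y jk k)%:R / (residual y jk k)%:R : R)
  @[k --> \oo] --> (0 : R).

Local Notation sigma := (trimmed_sd p y jk).

Lemma trimmed_var_near : \forall k \near \oo, 0 < trimmed_var p y jk k.
Proof.
move/cvgryPge : var_y => /(_ 1); apply: filterS => k; exact: lt_le_trans.
Qed.

Let sigma_sqr k : 0 < trimmed_var p y jk k -> sigma k ^+ 2 = trimmed_var p y jk k.
Proof. by move=> /ltW; exact: sqr_sqrtr. Qed.

Let sigma_gt0 k : 0 < trimmed_var p y jk k -> 0 < sigma k.
Proof. by rewrite sqrtr_gt0. Qed.

(** The largest remaining weight divided by [sigma k], written through the ratio in [max0]. *)
Let delta k : R :=
  Num.sqrt (q^-1 * ((residual_max y jk k)%:R / (residual y jk k)%:R)).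

Let sqrt_cvg0 (f : nat -> R) : f k @[k --> \oo] --> (0 : R) ->
  Num.sqrt (q^-1 * f k) @[k --> \oo] --> (0 : R).
Proof.
move=> f0.
have qf0 : q^-1 * f k @[k --> \oo] --> (q^-1 * 0 : R).
  by apply: cvgM => //; exact: cvg_cst.
have := cvg_comp _ _ qf0 (@sqrt_continuous R (q^-1 * 0)).
by rewrite mulr0 sqrtr0.
Qed.

Let delta_cvg0 : delta k @[k --> \oo] --> (0 : R).
Proof. exact: sqrt_cvg0. Qed.

Let normalized k i : 0 < trimmed_var p y jk k ->
  (y i)%:R / sigma k = Num.sqrt (q^-1 * ((y i ^ 2)%N%:R / (residual y jk k)%:R)).
Proof.
move=> v0; rewrite -[LHS]ger0_norm ?divr_ge0 ?sqrtr_ge0// -sqrtr_sqr.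
rewrite expr_div_n sigma_sqr// natrX /trimmed_var -/q invfM.
by congr Num.sqrt; ring.
Qed.

Let normalized_le k (j : 'I_k) : 0 < trimmed_var p y jk k ->
  j != jk k :> nat -> 0 <= (y j)%:R / sigma k <= delta k.
Proof.
move=> v0 jj; rewrite divr_ge0 ?sqrtr_ge0//= normalized// ler_wsqrtr//.
apply: ler_wpM2l; first by rewrite invr_ge0 ltW.
rewrite ler_wpM2r ?invr_ge0// ler_nat.
by rewrite /residual_max (bigD1 j)//= leq_maxl.
Qed.

(** Each centred term is at most [y j] in absolute value. Once [delta k <= e], this is at most
    [e * sigma k], so every indicator vanishes and the Lindeberg sum is exactly 0. *)
Lemma trimmed_lindeberg : lindeberg_trimmed P p eps n y jk.
Proof.
move=> e e0; apply: cvg_near_cst; near=> k.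
have v0 : 0 < trimmed_var p y jk k by near: k; exact: trimmed_var_near.
have de : delta k <= e by near: k; apply: (cvgr_le _ delta_cvg0).
rewrite big1 ?mule0// => j jj.
rewrite (_ : (fun _ => _) = cst 0) ?expectation_cst//; apply/funext => t /=.
rewrite indicE memNset ?mulr0//=; apply/negP; rewrite -leNgt.
rewrite /summand /bool_to_real -mulrBl normrM (ger0_norm (x := (y j)%:R))//.
have /andP[_ yd] := normalized_le v0 jj.
have ys : (y j)%:R <= e * sigma k.
  by rewrite -ler_pdivrMr ?sigma_gt0// (le_trans yd).
rewrite (le_trans _ ys)// ler_piMl// ler_norml.
have := p_gt0; have := p_lt1.
by case: (eps (n j) t) => /= *; apply/andP; split; lra.
Unshelve. all: by end_near.
Qed.

Lemma trimmed_clt : cvg_in_distribution P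
  (fun k => standardize (trimmed_sum eps n y jk k)
     (fine 'E_P[trimmed_sum eps n y jk k]) (sigma k)) (normal_prob 0 1).
Proof.
apply: (iffRL (normal_cvgP _ (oner_neq0 R) (fun k => cdf_trimmed_sum k _))) => r.
apply: (bern_clt hp (a := fun k j => v j / sigma k) _ delta_cvg0).
  near=> k => j.
  have v0 : 0 < trimmed_var p y jk k by near: k; exact: trimmed_var_near.
  rewrite /v; case: ifPn => jj; last by rewrite mul0r lexx sqrtr_ge0.
  exact: normalized_le.
apply: cvg_near_cst; near=> k.
have v0 : 0 < trimmed_var p y jk k by near: k; exact: trimmed_var_near.
by rewrite bern_sum_var_div sigma_sqr// trimmed_weights_var divff// gt_eqF.
Unshelve. all: by end_near.
Qed.

Let alpha k := (y (jk k))%:R / sigma k.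

Lemma reinserted_clt :
  ((y (jk k) ^ 2)%N%:R / (residual y jk k)%:R : R) @[k --> \oo] --> (0 : R) ->
  cvg_in_distribution P
    (fun k => standardize (S k) (mean_sum eps n y P k) (sigma k))
    (normal_prob 0 1).
Proof.
move=> y0.
apply: (iffRL (normal_cvgP _ (oner_neq0 R) (fun k => cdf_partial_sum k _))) => r.
(* The sum of the two bounds covers both the remaining weights and the reinserted one; the variance
   becomes $1 + y_{j_k}^2/R_k$. *)
apply: (bern_clt hp (a := fun k (j : 'I_k) => (y j)%:R / sigma k)
  (delta := fun k => delta k +
    Num.sqrt (q^-1 * ((y (jk k) ^ 2)%N%:R / (residual y jk k)%:R)))).
- near=> k => j.
  have v0 : 0 < trimmed_var p y jk k by near: k; exact: trimmed_var_near.
  have [jj|jj] := eqVneq (j : nat) (jk k).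
    by rewrite jj divr_ge0 ?sqrtr_ge0//= normalized// lerDr sqrtr_ge0.
  have /andP[-> /= h] := normalized_le v0 jj.
  by rewrite (le_trans h)// lerDl sqrtr_ge0.
- by rewrite -[0](addr0 0); apply: cvgD => //; exact: sqrt_cvg0.
- have h : 1 + (y (jk k) ^ 2)%N%:R / (residual y jk k)%:R @[k --> \oo]
      --> (1 + 0 : R) by exact: cvgD (cvg_cst _) y0.
  rewrite addr0 in h; apply: (cvg_trans _ h); apply: near_eq_cvg; near=> k.
  have v0 : 0 < trimmed_var p y jk k by near: k; exact: trimmed_var_near.
  have k0 : (0 < k)%N by near: k; exact: nbhs_infty_gt.
  rewrite bern_sum_var_div sigma_sqr// (total_var_split (jkP k0)).
  rewrite mulrDl divff ?gt_eqF//; congr (_ + _).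
  rewrite natrX /trimmed_var -/q; field.
  by move: v0; rewrite /trimmed_var -/q pmulr_rgt0// => R0; rewrite !gt_eqF.
Unshelve. all: by end_near.
Qed.

(** The contrapositive of the failure claim: a normal limit for the full sum is a limit of mixtures,
    which forces [alpha] to 0, and the ratio in question is [q * alpha k ^+ 2]. *)
Lemma reinserted_not_normal (m s : R) : 0 < s ->
  cvg_in_distribution P
    (fun k => standardize (S k) (mean_sum eps n y P k) (sigma k))
    (normal_prob m s) ->
  ((y (jk k) ^ 2)%N%:R / (residual y jk k)%:R : R) @[k --> \oo] --> (0 : R).
Proof.
move=> s0 H; have sn0 : s != 0 by rewrite gt_eqF.
have {}H := iffLR (normal_cvgP _ sn0 (fun k => cdf_partial_sum k _)) H.
have jkS k : (jk k.+1 < k.+1)%N by exact: jkP.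
have varS : \forall k \near \oo, 0 < trimmed_var p y jk k.+1.
  by have [N _ HN] := trimmed_var_near; exists N => // k Nk; apply/HN/leqW.
have al0 : alpha k.+1 @[k --> \oo] --> (0 : R).
  apply: (mixture_not_normal hp (m := m) (s := s)) => //.
    by move=> k; rewrite divr_ge0 ?sqrtr_ge0.
  move=> r; apply: (bern_mixture_limit hp
    (a := fun k (j : 'I_k) => (y j)%:R / sigma k) (i := fun k => Ordinal (jkS k))
    _ delta_cvg0 _ (H r)).
    near=> k => j jj; apply: normalized_le => //.
    by near: k; exact: varS.
  near=> k.
  have v0 : 0 < trimmed_var p y jk k.+1 by near: k; exact: varS.
  rewrite (_ : (fun j : 'I_k.+1 => _) = fun j => v j / sigma k.+1).
    by rewrite bern_sum_var_div sigma_sqr// trimmed_weights_var divff// gt_eqF.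
  apply/funext => j; rewrite /v -val_eqE /=.
  by case: ifP => // _; rewrite mul0r.
have al1 : alpha k @[k --> \oo] --> (0 : R) by rewrite -(cvg_shiftS alpha).
have h : q * alpha k * alpha k @[k --> \oo] --> (q * 0 * 0 : R).
  by apply: cvgM => //; apply: cvgM => //; exact: cvg_cst.
rewrite mulr0 in h; apply: (cvg_trans _ h); apply: near_eq_cvg; near=> k.
have v0 : 0 < trimmed_var p y jk k by near: k; exact: trimmed_var_near.
rewrite /alpha -mulrA -expr2 expr_div_n sigma_sqr// natrX /trimmed_var -/q; field.
by move: v0; rewrite /trimmed_var -/q pmulr_rgt0// => R0; rewrite !gt_eqF.
Unshelve. all: by end_near.
Qed.

End trimmed.

(** * The regime dominated by one term *)

Section dominated.
Variable jk : nat -> nat.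
Hypothesis jkP : index_choice jk.
Hypothesis dom :
  ((y (jk k) ^ 2)%N%:R / (y (jk k) ^ 2 + residual y jk k)%N%:R : R)
    @[k --> \oo] --> (1 : R).

Let sum_sqrE k : (0 < k)%N ->
  (\sum_(j < k) y j ^ 2 = y (jk k) ^ 2 + residual y jk k)%N.
Proof.
by move=> k0; rewrite /residual (bigD1 (Ordinal (jkP k0))).
Qed.

(** A zero numerator would make the ratio 0, away from its limit 1. *)
Let y_near : \forall k \near \oo, (0 < y (jk k))%N.
Proof.
have : \forall k \near \oo,
    0 < ((y (jk k) ^ 2)%N%:R / (y (jk k) ^ 2 + residual y jk k)%N%:R : R).
  by apply: (cvgr_gt _ dom).
by apply: filterS => k; rewrite lt0n; apply: contraTneq => ->; rewrite mul0r ltxx.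
Qed.

Let var_gt0 k : (0 < k)%N -> (0 < y (jk k))%N ->
  0 < (\sum_(j < k) y j ^ 2)%N%:R :> R.
Proof. by move=> k0 yk; rewrite sum_sqrE// ltr0n addn_gt0 expn_gt0 yk. Qed.

Lemma dominated_variance :
  fine 'V_P[summand eps n y (jk k)] / fine 'V_P[S k] @[k --> \oo] --> (1 : R).
Proof.
apply: (cvg_trans _ dom); apply: near_eq_cvg; near=> k.
have k0 : (0 < k)%N by near: k; exact: nbhs_infty_gt.
have yk : (0 < y (jk k))%N by near: k; exact: y_near.
rewrite (variance_summand (jkP k0)) (partial_sum_moments k).2 /= -sum_sqrE//.
have := var_gt0 k0 yk; set V := (\sum_(j < k) y j ^ 2)%N%:R => V0.
by rewrite -/q; field; rewrite ?(gt_eqF V0) ?(gt_eqF q_gt0).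
Unshelve. all: by end_near.
Qed.

(** The limit of the largest weight divided by the standard deviation. *)
Let c := (Num.sqrt q)^-1.
Let sq_gt0 : 0 < Num.sqrt q. Proof. by rewrite sqrtr_gt0. Qed.
Let sigma := sd_sum eps n y P.

Lemma dominated_cdf (r : R) : r != - (c * p) -> r != c * (1 - p) ->
  bern_mean p (fun b => (bern_sum p (fun j : 'I_k => (y j)%:R / sigma k) b <= r)%R%:R)
    @[k --> \oo] --> two_point_cdf p (- (c * p)) (c * (1 - p)) r.
Proof.
move=> r0 r1.
pose e := Num.min `|r - c * (1 - p)| `|r + c * p|.
have e0 : 0 < e.
  by rewrite lt_min !normr_gt0 subr_eq0 r1 -[c * p]opprK subr_eq0.
have e1 : e <= `|r - c * (1 - p)| by rewrite ge_min lexx.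
have e2 : e <= `|r + c * p| by rewrite ge_min lexx orbT.
pose ratio k : R :=
  (y (jk k) ^ 2)%N%:R / (y (jk k) ^ 2 + residual y jk k)%N%:R.
(* With [a] the normalized largest weight, total variance 1 and $qc^2 = 1$, the difference has
   variance $1 - qa^2 + q(a-c)^2 = 2 - 2\sqrt{q}\,a$, and $\sqrt{q}\,a$ is the root of the ratio. *)
apply: (@cvg_dist_bound _ (fun=> two_point_cdf p (- (c * p)) (c * (1 - p)) r) _
  (fun k => (2 - 2 * Num.sqrt (ratio k)) / e ^+ 2)); last exact: cvg_cst.
- near=> k.
  have k0 : (0 < k)%N by near: k; exact: nbhs_infty_gt.
  have yk : (0 < y (jk k))%N by near: k; exact: y_near.
  rewrite distrC; pose i := Ordinal (jkP k0).
  apply: le_trans (bern_two_point hp (fun j : 'I_k => (y j)%:R / sigma k)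
    i e0 e1 e2) _.
  have V0 := var_gt0 k0 yk; set V := (\sum_(j < k) y j ^ 2)%N%:R in V0.
  have sE : sigma k = Num.sqrt (q * V).
    by rewrite /sigma /sd_sum (partial_sum_moments k).2.
  have sE2 : sigma k ^+ 2 = q * V by rewrite sE sqr_sqrtr// ltW// mulr_gt0.
  have s0 : 0 < sigma k by rewrite sE sqrtr_gt0 mulr_gt0.
  have sr : Num.sqrt q * ((y (jk k))%:R / sigma k) = Num.sqrt (ratio k).
    have a0 : 0 <= Num.sqrt q * ((y (jk k))%:R / sigma k).
      by rewrite mulr_ge0 ?sqrtr_ge0// divr_ge0// ltW.
    rewrite -[LHS]ger0_norm// -sqrtr_sqr.
    rewrite exprMn expr_div_n sE2 (sqr_sqrtr (ltW q_gt0)) /ratio -sum_sqrE// -/V natrX.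
    by congr Num.sqrt; field; rewrite ?(gt_eqF V0) ?(gt_eqF q_gt0).
  have := bern_sum_var_split p (fun j : 'I_k => (y j)%:R / sigma k) i.
  rewrite bern_sum_var_div sE2 /bern_sum_var -/q.
  rewrite (eq_bigr (fun j : 'I_k => (y j ^ 2)%N%:R)); last first.
    by move=> j _; rewrite natrX.
  have qV0 : q * V != 0 by rewrite gt_eqF// mulr_gt0.
  rewrite -natr_sum -/V divff// => var1.
  have := bern_sum_var_split p
    (fun j : 'I_k => (y j)%:R / sigma k - (if j == i then c else 0)) i.
  rewrite /bern_sum_var -/q eqxx => ->.
  under eq_bigr => j _.
    rewrite (_ : (if j != i then _ else 0) =
      (if j != i then (y j)%:R / sigma k else 0)); last first.
      by case: eqP => //= _; rewrite subr0.
    over.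
  rewrite -[X in X + _](addrK (q * ((y i)%:R / sigma k) ^+ 2)) -var1.
  rewrite ler_wpM2r ?invr_ge0 ?sqr_ge0// -sr /= /c.
  set a := (y (jk k))%:R / sigma k.
  rewrite le_eqVlt; apply/orP; left; apply/eqP.
  have hq := sqr_sqrtr (ltW q_gt0); have := gt_eqF sq_gt0.
  move: (Num.sqrt q) hq => z hq z0; rewrite -hq; field.
  by rewrite z0.
- rewrite [X in _ --> X](_ : 0 = (2 - 2 * Num.sqrt 1) / e ^+ 2); last first.
    by rewrite sqrtr1 mulr1 subrr mul0r.
  apply: cvgM; last exact: cvg_cst.
  apply: cvgB; first exact: cvg_cst.
  apply: cvgM; first exact: cvg_cst.
  exact: (cvg_comp _ _ dom (@sqrt_continuous R 1)).
Unshelve. all: by end_near.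
Qed.

(** Between its two atoms the limiting distribution function is constant, whereas a normal one is
    strictly increasing. *)
Lemma dominated_not_normal (m s : R) : 0 < s ->
  ~ cvg_in_distribution P
    (fun k => standardize (S k) (mean_sum eps n y P k) (sigma k))
    (normal_prob m s).
Proof.
move=> s0 H; have sn0 : s != 0 by rewrite gt_eqF.
have {}H := iffLR (normal_cvgP _ sn0 (fun k => cdf_partial_sum k _)) H.
have c0 : 0 < c by rewrite invr_gt0.
have cp : 0 < c * p by rewrite mulr_gt0.
have cq : 0 < c * (1 - p) by rewrite mulr_gt0// subr_gt0.
have inner r : - (c * p) < r -> r < c * (1 - p) -> normal_cdf m s r = 1 - p.
  move=> h0 h1; have := dominated_cdf (negbT (gt_eqF h0)) (negbT (lt_eqF h1)).
  have -> : two_point_cdf p (- (c * p)) (c * (1 - p)) r = 1 - p.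
    by rewrite /two_point_cdf (ltW h0) leNgt h1 /= mulr0 add0r mulr1.
  by move=> h; exact: (cvg_unique (@Rhausdorff R) (H r) h).
have : normal_cdf m s 0 < normal_cdf m s (c * (1 - p) / 2).
  by rewrite normal_cdf_lt// divr_gt0.
by rewrite !inner ?ltxx//; lra.
Qed.

End dominated.

Lemma two_point_law d' (T' : measurableType d') (P' : probability T' R)
    (B : {RV P' >-> bool}) : has_law P' B (bernoulli_prob p) ->
  has_law P' (standardize (bool_to_real B) p (Num.sqrt (p * (1 - p))))
    (fun A : set R =>
       p%:E * \d_(((1 - p) / Num.sqrt (p * (1 - p)))%R) A +
       (1 - p)%:E * \d_((- p / Num.sqrt (p * (1 - p)))%R) A)%E.
Proof.
move=> HB A mA.
pose f (b : bool) : R := (b%:R - p) / Num.sqrt (p * (1 - p)).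
transitivity (distribution P' B (f @^-1` A)); first by [].
rewrite HB// bernoulli_probE; last by rewrite !ltW.
have dE b : (\d_b (f @^-1` A) = \d_(f b) A :> \bar R)%E.
  by rewrite !diracE; congr ((nat_of_bool _)%:R%:E); apply/idP/idP => /set_mem ?;
    exact/mem_set.
by rewrite !dE /f /= sub0r.
Qed.

(** Just left of an atom the function is lower by at least [p] or [1 - p]; the other step is
    monotone and cannot compensate. *)
Lemma two_point_continuity (l0 l1 r : R) :
  {for r, continuous (fun u : R => (two_point_cdf p l0 l1 u)%:E)} ->
  r != l0 /\ r != l1.
Proof.
move=> /fine_cvg /= /cvgrPdist_lt cr.
have p1 : 0 < 1 - p by rewrite subr_gt0.
have e0 : 0 < Num.min p (1 - p) by rewrite lt_min p_gt0.
have /nbhs_ballP[e /= e1 He] := cr _ e0.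
have re : ball r e (r - e / 2).
  by rewrite /ball /= opprD opprK addNKr gtr0_norm; lra.
have {He} := He _ re; rewrite /two_point_cdf /= => H.
split; apply/eqP => rl; move: H; rewrite -rl lexx.
  have -> : (r <= r - e / 2) = false by apply/negbTE; rewrite -ltNge; lra.
  have h : (l1 <= r - e / 2)%R%:R <= (l1 <= r)%R%:R :> R.
    by rewrite ler_nat; case: (lerP l1 (r - e / 2)) => // h; have -> : l1 <= r by lra.
  rewrite /= mulr0 addr0 mulr1 ltr_norml lt_min => /andP[_ /andP[_ H]].
  by have := ler_wpM2l (ltW p_gt0) h; lra.
have -> : (r <= r - e / 2) = false by apply/negbTE; rewrite -ltNge; lra.
have h : (l0 <= r - e / 2)%R%:R <= (l0 <= r)%R%:R :> R.
  by rewrite ler_nat; case: (lerP l0 (r - e / 2)) => // h; have -> : l0 <= r by lra.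
rewrite /= mulr0 add0r mulr1 ltr_norml lt_min => /andP[_ /andP[H _]].
by have := ler_wpM2l (ltW p1) h; lra.
Qed.

Lemma dominated_limit (jk : nat -> nat) (jkP : index_choice jk)
    (dom : ((y (jk k) ^ 2)%N%:R / (y (jk k) ^ 2 + residual y jk k)%N%:R : R)
      @[k --> \oo] --> (1 : R))
    d' (T' : measurableType d') (P' : probability T' R)
    (B : {RV P' >-> bool}) : has_law P' B (bernoulli_prob p) ->
  cvg_in_distribution P
    (fun k => standardize (S k) (mean_sum eps n y P k) (sd_sum eps n y P k))
    (distribution P' (standardize (bool_to_real B) p (Num.sqrt (p * (1 - p))))).
Proof.
move=> /two_point_law HL r.
have LE u : distribution P'
    (standardize (bool_to_real B) p (Num.sqrt (p * (1 - p)))) `]-oo, u] =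
    (two_point_cdf p (- ((Num.sqrt q)^-1 * p)) ((Num.sqrt q)^-1 * (1 - p)) u)%:E.
  rewrite HL// !diracE !mem_setE !in_itv /= /two_point_cdf -!EFinM -EFinD -/q.
  by rewrite mulNr [p / _]mulrC [(1 - p) / _]mulrC.
rewrite LE; have /funext -> := LE; move=> /two_point_continuity[r0 r1].
under eq_fun do rewrite cdf_partial_sum.
apply: cvg_EFin; first exact: nearW.
exact: (dominated_cdf jkP dom).
Qed.

End bernoulli_regimes.

(** * Atoms as finite sums *)

Section atoms.
Context d (T : measurableType d) (R : realType) (P : probability T R).
Context (eps : nat -> {RV P >-> bool}) (n : nat -> nat) (n_inj : injective n).
Context (x y : nat -> nat) (hy : forall j, y j = x (n j)).

Lemma pmf_gt0_value (X : {RV P >-> R}) (a : R) :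
  0 < pmf X a -> exists t, X t = a.
Proof.
rewrite /pmf => h; suff /set0P[t Xt] : X @^-1` [set a] != set0 by exists t.
by apply: contraTneq h => ->; rewrite measure0 ltxx.
Qed.

(** The image of [G] under [n] is the index set in [x]; injectivity prevents terms from merging. *)
Lemma subset_sum_FS k (G : {set 'I_k}) :
  G != finset.set0 -> FS x (\sum_(j in G) y j)%N.
Proof.
move=> /finset.set0Pn[i iG]; exists [fset n (nat_of_ord j) | j in G]%fset.
  by apply/fset0Pn; exists (n i); apply/imfsetP; exists i.
rewrite big_imfset /=; last by move=> i1 i2 _ _ /n_inj/ord_inj.
by rewrite big_enum_cond /=; apply: eq_big => // j; rewrite ?andbT.
Qed.

Lemma summand_sum_atom k (Q : pred 'I_k) (t : T) :
  atom_in_FS x y k (\sum_(j < k | Q j) summand eps n y j t : R).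
Proof.
exists [set j | Q j && eps (n j) t]%SET; split; last exact: subset_sum_FS.
rewrite natr_sum big_mkcond [RHS]big_mkcond; apply: eq_bigr => j _.
rewrite inE /summand /bool_to_real.
by case: (Q j) => //=; case: (eps _ _); rewrite ?mul1r ?mul0r.
Qed.

End atoms.

Lemma increasing_injective (n : nat -> nat) :
  {homo n : i j / (i < j)%N >-> (i < j)%N} -> injective n.
Proof.
by move=> n_incr i j nij; case: (ltngtP i j) => // /n_incr; rewrite nij ltnn.
Qed.

Theorem theorem6
  (r : nat) (c : nat -> 'I_r) (x : nat -> nat)
  (hmono : monochromatic c (FS x))
  (R : realType) (p : R) (hp : 0 < p < 1)
  (d : measure_display) (T : measurableType d) (P : probability T R)
  (eps : nat -> {RV P >-> bool}) (heps : iid_bernoulli P p eps)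
  (n : nat -> nat) (hn : {homo n : i j / (i < j)%N >-> (i < j)%N})
  (y : nat -> nat) (hy : forall j, y j = x (n j)) (hinj : injective y)
  (hdiv : (\sum_(0 <= j <oo) ((y j ^ 2)%N%:R)%:E = +oo :> \bar R)%E) :
  let S := partial_sum eps n y in
  let mu := mean_sum eps n y P in
  let sigma := sd_sum eps n y P in
  let Strim := trimmed_sum eps n y in
  [/\ (forall k, 'E_P[S k] = (p * (\sum_(j < k) y j)%N%:R)%:E /\
        'V_P[S k] = (p * (1 - p) * (\sum_(j < k) y j ^ 2)%N%:R)%:E)%E,
      (forall jk : nat -> nat, argmax_choice y jk ->
        ((y (jk k) ^ 2)%N%:R / (y (jk k) ^ 2 + residual y jk k)%N%:R : R)
          @[k --> \oo] --> (1 : R) ->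
        [/\ fine 'V_P[summand eps n y (jk k)] / fine 'V_P[S k]
              @[k --> \oo] --> (1 : R),
            (forall (d' : measure_display) (T' : measurableType d')
               (P' : probability T' R) (B : {RV P' >-> bool}),
               has_law P' B (bernoulli_prob p) ->
               let L := standardize (bool_to_real B) p
                          (Num.sqrt (p * (1 - p))) in
               cvg_in_distribution P
                 (fun k => standardize (S k) (mu k) (sigma k))
                 (distribution P' L) /\
               has_law P' L (fun A : set R =>
                 p%:E * \d_(((1 - p) / Num.sqrt (p * (1 - p)))%R) A +
                 (1 - p)%:E * \d_((- p / Num.sqrt (p * (1 - p)))%R) A)%E)
          & (forall m s : R, 0 < s ->
               ~ cvg_in_distribution P
                   (fun k => standardize (S k) (mu k) (sigma k))
                   (normal_prob m s))]),
      (forall jk : nat -> nat, index_choice jk ->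
        trimmed_var p y jk k @[k --> \oo] --> +oo ->
        ((residual_max y jk k)%:R / (residual y jk k)%:R : R)
          @[k --> \oo] --> (0 : R) ->
        [/\ lindeberg_trimmed P p eps n y jk,
            cvg_in_distribution P
              (fun k => standardize (Strim jk k) (fine 'E_P[Strim jk k])
                          (trimmed_sd p y jk k))
              (normal_prob 0 1),
            (((y (jk k) ^ 2)%N%:R / (residual y jk k)%:R : R)
               @[k --> \oo] --> (0 : R) ->
             cvg_in_distribution P
               (fun k => standardize (S k) (mu k) (trimmed_sd p y jk k))
               (normal_prob 0 1))
          & (~ (((y (jk k) ^ 2)%N%:R / (residual y jk k)%:R : R)
                  @[k --> \oo] --> (0 : R)) ->
             forall m s : R, 0 < s ->
             ~ cvg_in_distribution P
                 (fun k => standardize (S k) (mu k) (trimmed_sd p y jk k))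
                 (normal_prob m s))])
    & (forall (k : nat) (a : R),
        (0 < pmf (P := P) (S k) a -> atom_in_FS x y k a) /\
        (forall jk : nat -> nat, index_choice jk ->
           0 < pmf (P := P) (Strim jk k) a -> atom_in_FS x y k a))].
Proof.
move=> S mu sigma Strim; have n_inj := increasing_injective hn; split.
- by move=> k; exact: (partial_sum_moments hp heps n_inj).
- move=> jk [jkP _] dom; split.
  + exact: (dominated_variance hp heps n_inj jkP dom).
  + move=> d' T' P' B HB; split; last exact: two_point_law.
    exact: (dominated_limit hp heps n_inj jkP dom).
  + move=> m s; exact: (dominated_not_normal hp heps n_inj jkP dom).
- move=> jk jkP var_y max0; split.
  + exact: (trimmed_lindeberg hp).
  + exact: (trimmed_clt hp heps n_inj).
  + exact: (reinserted_clt hp heps n_inj jkP).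
  + move=> ny m s s0; apply: contra_not ny.
    exact: (reinserted_not_normal hp heps n_inj jkP var_y max0 s0).
- move=> k a; split=> [|jk _] /pmf_gt0_value[t <-].
    exact: (summand_sum_atom eps n_inj hy xpredT).
  exact: (summand_sum_atom eps n_inj hy (fun j : 'I_k => j != jk k :> nat)).
Qed.
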